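(* Let $\mathbb{X},\mathbb{Y}$ be finite dimensional real Hilbert spaces and let $f:\mathbb{X}\to\mathbb{R}\cup\{\infty\}$ be $$f(x):=\ell(\mathcal{A}x)+\langle v,x\rangle+\gamma(x),$$ where $\gamma$ is a closed gauge whose polar gauge $\gamma^\circ$ is $C^2$-cone reducible, $\ell:\mathbb{Y}\to\mathbb{R}$ is strongly convex on any compact convex set and has locally Lipschitz gradient, $\mathcal{A}:\mathbb{X}\to\mathbb{Y}$ is a linear map, and $v\in\mathbb{X}$. Suppose that $0\in\partial f(\bar x)$ and $\gamma(\bar x)>0$. Then $\gamma^\circ(-\mathcal{A}^*\nabla\ell(\mathcal{A}\bar x)-v)=1$. Suppose in addition that $-\mathcal{A}^*\nabla\ell(\mathcal{A}\bar x)-v\in\operatorname{dom}\partial\gamma^\circ$ and that $$\mathcal{A}^{-1}\{\mathcal{A}\bar x\}\cap\Big(\bigcup_{\lambda>0}\lambda\big(\operatorname{ri}\partial\gamma^\circ(-\mathcal{A}^*\nabla\ell(\mathcal{A}\bar x)-v)\big)\Big)\neq\emptyset.$$ Then $f$ satisfies the KL property at $\bar x$ with exponent $\frac12$.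
   Context: A gauge is a convex function $\gamma:\mathbb{X}\to\mathbb{R}\cup\{\infty\}$ that is nonnegative, positively homogeneous and vanishes at the origin; closed means lower semicontinuous. Its polar gauge is $\gamma^\circ(x)=\sup_z\{\langle x,z\rangle:\gamma(z)\le1\}$. $\operatorname{ri}$ is relative interior; $\mathcal{A}^*$ is the adjoint. A closed set $\mathfrak{D}$ in a finite dimensional Hilbert space $\mathbb{W}$ is $C^2$-cone reducible at $\bar w\in\mathfrak{D}$ if there exist a finite dimensional Hilbert space $\mathbb{V}$, a closed convex pointed cone $K\subseteq\mathbb{V}$, $\rho>0$ and a mapping $\Theta:\mathbb{W}\to\mathbb{V}$ with $\Theta(\bar w)=0$, twice continuously differentiable in the closed ball $B(\bar w,\rho)$, with derivative $D\Theta(\bar w)$ onto, such that $\mathfrak{D}\cap B(\bar w,\rho)=\{w:\Theta(w)\in K\}\cap B(\bar w,\rho)$. It is $C^2$-cone reducible if this holds at every $\bar w\in\mathfrak{D}$. An extended-real-valued function is $C^2$-cone reducible if its epigraph $\{(x,t):h(x)\le t\}$ is a $C^2$-cone reducible set. A function $h$ is proper if $\operatorname{dom}h:=\{x:h(x)<\infty\}\neq\emptyset$ and it is never $-\infty$. For proper convex $h$, $\partial h$ is the usual convex subdifferential, with $\partial h(x)=\emptyset$ for $x\notin\operatorname{dom}h$, and $\operatorname{dom}\partial h:=\{x:\partial h(x)\ne\emptyset\}$. Write $\operatorname{dist}(x,D):=\inf_{y\in D}\|x-y\|$ (with value $\infty$ if $D=\emptyset$). A proper closed $h$ satisfies the Kurdyka-Łojasiewicz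 (KL) property at $\hat x\in\operatorname{dom}\partial h$ with exponent $\alpha\in[0,1)$ if there exist $a\in(0,\infty]$, a neighborhood $V$ of $\hat x$ and $\bar c>0$ such that, with $\varphi(s)=\bar c s^{1-\alpha}$, $\varphi'(h(x)-h(\hat x))\operatorname{dist}(0,\partial h(x))\ge1$ for every $x\in V$ with $h(\hat x)<h(x)<h(\hat x)+a$. *)

(* Defs.v *)
From HB Require Import structures.
From mathcomp Require Import all_boot all_order all_algebra.
From mathcomp Require Import all_classical all_reals all_analysis.
From mathcomp Require Import ring.
Set Implicit Arguments.
Unset Strict Implicit.
Unset Printing Implicit Defensive.
Import Order.TTheory GRing.Theory Num.Theory.
Import numFieldNormedType.Exports.
Local Open Scope classical_set_scope.
Local Open Scope ring_scope.

(* Finite-dimensional real Hilbert spaces: the norm (hence the topology) of the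
   normed module is the one induced by the inner product. *)
HB.mixin Record isEuclidean (R : realType) V
    & NormedModule R V & Vector R V := {
  inner : V -> V -> R ;
  innerC : forall x y, inner x y = inner y x ;
  innerDl : forall x y z, inner (x + y) z = inner x z + inner y z ;
  innerZl : forall (a : R) x y, inner (a *: x) y = a * inner x y ;
  inner_norm : forall x, inner x x = `|x| ^+ 2 }.

#[short(type="euclideanType")]
HB.structure Definition Euclidean (R : realType) :=
  {V of NormedModule R V & Vector R V & isEuclidean R V}.

Section inner_theory.
Context {R : realType} {V : euclideanType R}.
Implicit Types x y z : V.

Lemma innerDr x y z : inner x (y + z) = inner x y + inner x z.
Proof. by rewrite innerC innerDl ![inner x _]innerC. Qed.

Lemma innerZr (a : R) x y : inner x (a *: y) = a * inner x y.
Proof. by rewrite innerC innerZl innerC. Qed.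

Lemma inner_linear_subproof x : linear (inner x : V -> R^o).
Proof. by move=> a y z; rewrite innerDr innerZr. Qed.

HB.instance Definition _ x :=
  GRing.isLinear.Build R V R^o *:%R (inner x) (inner_linear_subproof x).

Lemma inner_sqD x y :
  `|x + y| ^+ 2 = `|x| ^+ 2 + inner x y *+ 2 + `|y| ^+ 2.
Proof.
rewrite -!inner_norm innerDl !innerDr (innerC y x) mulr2n.
by rewrite !addrA.
Qed.

Lemma cauchy_schwarz x y : inner x y <= `|x| * `|y|.
Proof.
have : `|x + y| ^+ 2 <= (`|x| + `|y|) ^+ 2.
  by rewrite ler_sqr ?nnegrE ?addr_ge0 // ler_normD.
by rewrite inner_sqD sqrrD lerD2r lerD2l lerMn2r.
Qed.

End inner_theory.

(* The element representing a linear form (0 if the form is not linear). *)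
Definition riesz (R : realType) (V : euclideanType R) (phi : V -> R) : V :=
  xget 0 [set g | forall h, phi h = inner g h].

Lemma rieszP (R : realType) (V : euclideanType R) (phi : {linear V -> R^o}) h :
  phi h = inner (riesz phi) h.
Proof.
rewrite /riesz; case: xgetP => [g _ /(_ h) //|/(_ _)/= none]; exfalso.
pose J (v : V) : 'Hom(V, R^o) := linfun (inner v : V -> R^o).
have Jl : linear J.
  move=> a u v; apply/lfunP => w.
  by rewrite add_lfunE scale_lfunE !lfunE/= innerDl innerZl.
pose JL : {linear V -> 'Hom(V, R^o)} :=
  HB.pack J (GRing.isLinear.Build _ _ _ _ J Jl).
have kerJ : lker (linfun JL) == 0%VS.
  rewrite -subv0; apply/subvP => v. rewrite memv_ker memv0 lfunE/= => /eqP Jv.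
  have := congr1 (fun f : 'Hom(V, R^o) => f v) Jv.
  rewrite lfunE/= zero_lfunE inner_norm => /eqP.
  by rewrite sqrf_eq0 normr_eq0.
have : linfun phi \in limg (linfun JL).
  suff -> : limg (linfun JL) = fullv by rewrite memvf.
  apply/eqP; rewrite eqEdim subvf /= limg_dim_eq; last first.
    by rewrite (eqP kerJ) capv0.
  by rewrite !dimvf /= /dim /= muln1.
case/memv_imgP => g _ E; apply: (none g) => k.
have := congr1 (fun f : 'Hom(V, R^o) => f k) E.
by rewrite !lfunE/= => ->.
Qed.

Section euclidean_line.
Context {R : realType}.

Let linnerC (x y : R^o) : x * y = y * x. Proof. exact: mulrC. Qed.
Let linnerDl (x y z : R^o) : (x + y) * z = x * z + y * z.
Proof. exact: mulrDl. Qed.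
Let linnerZl (a : R) (x y : R^o) : (a *: x) * y = a * (x * y).
Proof. by rewrite -mulrA. Qed.
Let linner_norm (x : R^o) : x * x = `|x| ^+ 2.
Proof. by rewrite real_normK ?num_real. Qed.

HB.instance Definition _ :=
  isEuclidean.Build R R^o linnerC linnerDl linnerZl linner_norm.
End euclidean_line.

(* Product with inner product <x,x'> + <y,y'>. The library's normed module
   on X * Y carries the max norm, hence a fresh name for the carrier. *)
Definition hprod (R : realType) (X Y : euclideanType R) : Type := (X * Y)%type.

Section hprod.
Context {R : realType} {X Y : euclideanType R}.
Local Notation W := (hprod X Y).

HB.instance Definition _ := GRing.Lmodule.copy W (X * Y)%type.
HB.instance Definition _ := Vector.copy W (X * Y)%type.

Let pinner (u w : W) : R := inner u.1 w.1 + inner u.2 w.2.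
Let pnorm (u : W) : R := Num.sqrt (pinner u u).

Let pinnerC u w : pinner u w = pinner w u.
Proof. by rewrite /pinner innerC (innerC u.2). Qed.
Let pinnerDl u v w : pinner (u + v) w = pinner u w + pinner v w.
Proof. by rewrite /pinner /= !innerDl addrACA. Qed.
Let pinnerZl (a : R) u w : pinner (a *: u) w = a * pinner u w.
Proof. by rewrite /pinner /= !innerZl mulrDr. Qed.
Let pinnerE u : pinner u u = `|u.1| ^+ 2 + `|u.2| ^+ 2.
Proof. by rewrite /pinner !inner_norm. Qed.
Let pinner_ge0 u : 0 <= pinner u u.
Proof. by rewrite pinnerE addr_ge0 ?sqr_ge0. Qed.
Let pnorm_sq u : pnorm u ^+ 2 = pinner u u.
Proof. by rewrite sqr_sqrtr. Qed.

Let pnormD u w : pnorm (u + w) <= pnorm u + pnorm w.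
Proof.
have CS : pinner u w <= pnorm u * pnorm w.
  apply: (@le_trans _ _ (`|u.1| * `|w.1| + `|u.2| * `|w.2|)).
    by rewrite lerD // cauchy_schwarz.
  rewrite -ler_sqr ?nnegrE ?addr_ge0 ?mulr_ge0 ?sqrtr_ge0 //.
  rewrite exprMn !pnorm_sq !pinnerE -subr_ge0.
  rewrite [leRHS](_ : _ = (`|u.1| * `|w.2| - `|u.2| * `|w.1|) ^+ 2) ?sqr_ge0 //.
  by ring.
rewrite -ler_sqr ?nnegrE ?addr_ge0 ?sqrtr_ge0 //.
rewrite sqrrD !pnorm_sq pinnerDl !(pinnerC _ (u + w)) !pinnerDl (pinnerC w u).
by rewrite addrA lerD2r -addrA lerD2l -mulr2n lerMn2r.
Qed.

Let pnormZ (a : R) u : pnorm (a *: u) = `|a| * pnorm u.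
Proof.
by rewrite /pnorm pinnerZl pinnerC pinnerZl mulrA -expr2 sqrtrM ?sqr_ge0 //
   sqrtr_sqr.
Qed.

Let pnorm_eq0 u : pnorm u = 0 -> u = 0.
Proof.
move=> u0; have /eqP := pnorm_sq u; rewrite u0 expr0n /= eq_sym pinnerE.
rewrite paddr_eq0 ?sqr_ge0 // !sqrf_eq0 !normr_eq0.
by case: u {u0} => a b /= /andP[/eqP -> /eqP ->].
Qed.

HB.instance Definition _ := Lmodule_isNormed.Build R W pnormD pnormZ pnorm_eq0.

Let pinner_norm (u : W) : pinner u u = `|u| ^+ 2.
Proof. by rewrite -pnorm_sq. Qed.

HB.instance Definition _ :=
  isEuclidean.Build R W pinnerC pinnerDl pinnerZl pinner_norm.
End hprod.

Definition gradient (R : realType) (Y : euclideanType R) (l : Y -> R) (y : Y)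
  : Y := riesz ('d l y : Y -> R).

Definition adjoint (R : realType) (X Y : euclideanType R) (A : X -> Y) (y : Y)
  : X := riesz (fun x => inner (A x) y).

Lemma gradientP (R : realType) (Y : euclideanType R) (l : Y -> R) y h :
  'd l y h = inner (gradient l y) h.
Proof. exact: rieszP ('d l y) h. Qed.

Lemma adjointP (R : realType) (X Y : euclideanType R) (A : {linear X -> Y})
    x y : inner (A x) y = inner x (adjoint A y).
Proof.
rewrite (innerC x); pose phi := (fun x => inner (A x) y) : X -> R^o.
have phil : linear phi by move=> a u w; rewrite /phi linearP innerDl innerZl.
pose phiL : {linear X -> R^o} :=
  HB.pack phi (GRing.isLinear.Build _ _ _ _ phi phil).
exact: (rieszP phiL x).
Qed.

(* In finite dimension, differentiability of z |-> DF(z) (and continuity of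
   w |-> D^2F(w)) can be stated after evaluation at each fixed vector, which
   avoids norming the space of linear maps. *)
Definition twice_differentiable (R : realType) (W V : normedModType R)
    (F : W -> V) (w : W) : Prop :=
  (\forall z \near w, differentiable F z) /\
  forall h, differentiable (fun z => 'd F z h) w.

Definition C2_on (R : realType) (W V : normedModType R) (D : set W)
    (F : W -> V) : Prop :=
  (forall w, D w -> twice_differentiable F w) /\
  forall h k, {within D, continuous (fun w => 'd (fun z => 'd F z h) w k)}.

Definition is_cone (R : realType) (V : lmodType R) (K : set V) : Prop :=
  forall (t : R) (x : V), 0 < t -> K x -> K (t *: x).

Definition pointed_cone (R : realType) (V : lmodType R) (K : set V) : Prop :=
  K `&` [set x | K (- x)] = [set 0].

Definition C2_cone_reducible_at (R : realType) (W : euclideanType R)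
    (D : set W) (w0 : W) : Prop :=
  exists (V : euclideanType R) (K : set V) (rho : R) (Theta : W -> V),
    [/\ [/\ closed K, convex_set K, is_cone K & pointed_cone K],
        0 < rho /\ Theta w0 = 0,
        C2_on (closed_ball w0 rho) Theta,
        (forall v, exists h, 'd Theta w0 h = v) &
        D `&` closed_ball w0 rho =
          [set w | K (Theta w)] `&` closed_ball w0 rho].

Definition C2_cone_reducible_set (R : realType) (W : euclideanType R)
    (D : set W) : Prop :=
  closed D /\ forall w, D w -> C2_cone_reducible_at D w.

Definition epigraph (R : realType) (X : euclideanType R) (h : X -> \bar R) :
    set (hprod X R^o) :=
  [set p | (h p.1 <= p.2%:E)%E].

Definition C2_cone_reducible (R : realType) (X : euclideanType R)
    (h : X -> \bar R) : Prop := C2_cone_reducible_set (epigraph h).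

Section convex_analysis.
Context {R : realType} {X : euclideanType R}.
Implicit Types (h g : X -> \bar R) (C : set X).

Definition econvex h : Prop := forall (x y : X) (t : R), 0 <= t <= 1 ->
  (h (t *: x + (1 - t) *: y)%R <= t%:E * h x + (1 - t)%:E * h y)%E.

Definition gauge g : Prop :=
  [/\ econvex g, forall x, (0 <= g x)%E,
      forall (t : R) (x : X), 0 < t -> g (t *: x) = (t%:E * g x)%E & g 0 = 0%E].

Definition polar g (x : X) : \bar R :=
  ereal_sup [set (inner x z)%:E | z in [set z | (g z <= 1)%E]].

Definition edom h : set X := [set x | (h x < +oo)%E].

Definition proper_fun h : Prop := edom h !=set0 /\ forall x, h x != -oo%E.

Definition subdiff h (x : X) : set X :=
  [set g | edom h x /\ forall y, (h x + (inner g (y - x)%R)%:E <= h y)%E].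

Definition dom_subdiff h : set X := [set x | subdiff h x !=set0].

Definition affine_set C : Prop :=
  forall (x y : X) (t : R), C x -> C y -> C (t *: x + (1 - t) *: y).

Definition aff_hull C : set X := smallest affine_set C.

Definition rel_interior C : set X :=
  [set x | C x /\ exists2 e : R, 0 < e & ball x e `&` aff_hull C `<=` C].

(* The distance is +oo when D is empty. *)
Definition dist_to (x : X) (D : set X) : \bar R :=
  ereal_inf [set (`|x - y|)%:E | y in D].

Definition KL_property h (xhat : X) (alpha : R) : Prop :=
  [/\ proper_fun h /\ lower_semicontinuous h, dom_subdiff h xhat,
      0 <= alpha < 1 &
      exists (a : \bar R) (V : set X) (c : R),
        [/\ (0 < a)%E, nbhs xhat V, 0 < c &
            let phi (s : R) := c * s `^ (1 - alpha) in
            forall x, V x -> (h xhat < h x)%E -> (h x < h xhat + a)%E ->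
              (1 <= (phi^`()%classic (fine (h x - h xhat)))%:E
                    * dist_to (0 : X)%R (subdiff h x))%E]].

End convex_analysis.

Definition strongly_convex_on (R : realType) (Y : euclideanType R)
    (K : set Y) (l : Y -> R) : Prop :=
  exists2 sigma : R, 0 < sigma &
  forall (x y : Y) (t : R), K x -> K y -> 0 <= t <= 1 ->
    l (t *: x + (1 - t) *: y) <=
      t * l x + (1 - t) * l y - sigma / 2 * t * (1 - t) * `|x - y| ^+ 2.

Definition locally_lipschitz_gradient (R : realType) (Y : euclideanType R)
    (l : Y -> R) : Prop :=
  (forall y, differentiable l y) /\
  [locally [lipschitz (gradient l y) | y in setT]].

(* Main.v *)
Require Import Defs.
From HB Require Import structures.
From mathcomp Require Import all_boot all_order all_algebra.
From mathcomp Require Import all_classical all_reals all_analysis.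
From mathcomp Require Import ring lra.
Set Implicit Arguments.
Unset Strict Implicit.
Unset Printing Implicit Defensive.
Import Order.TTheory GRing.Theory Num.Theory.
Import numFieldNormedType.Exports.
Local Open Scope classical_set_scope.
Local Open Scope ring_scope.

(* Write u for the dual point, T for the tangent cone to {polar gam <= 1} at u
   and N for the polar cone of T. Strong convexity of l gives
     f x - f xbar >= s |A x - A xbar|^2 + (gam x - <u,x>),
   and every point of N in the fiber of A over A xbar is a minimizer of f.
   Cone reducibility and the Lyusternik theorem show that following a direction
   d of T from u stays within O(|d|^2) of {polar gam <= 1}; testing gam with the
   resulting dual points gives gam x - <u,x> >= c dist(x, N)^2 locally. The
   qualification condition provides a point of the fiber in the relative
   interior of N, so that the distance to the minimizers is controlled by
   |A x - A xbar| + dist(x, N). Hence f grows quadratically away from its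
   minimizers, and the subgradient inequality turns this growth into the KL
   property with exponent 1/2. *)

(** * Euclidean geometry *)

Section euclidean_basics.
Context {R : realType}.
Implicit Types (X : euclideanType R).

Lemma inner0l X (y : X) : inner 0 y = 0 :> R.
Proof. by rewrite -(scale0r (0 : X)) innerZl mul0r. Qed.

Lemma inner0r X (y : X) : inner y 0 = 0 :> R.
Proof. by rewrite innerC inner0l. Qed.

Lemma innerNl X (x y : X) : inner (- x) y = - inner x y.
Proof. by rewrite -scaleN1r innerZl mulN1r. Qed.

Lemma innerNr X (x y : X) : inner x (- y) = - inner x y.
Proof. by rewrite innerC innerNl innerC. Qed.

Lemma innerBl X (x y z : X) : inner (x - y) z = inner x z - inner y z.
Proof. by rewrite innerDl innerNl. Qed.

Lemma innerBr X (x y z : X) : inner x (y - z) = inner x y - inner x z.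
Proof. by rewrite innerDr innerNr. Qed.

Definition innerE X := (@innerDl R X, @innerDr R X, @innerBl X, @innerBr X,
  @innerZl R X, @innerZr R X, @innerNl X, @innerNr X, @inner0l X, @inner0r X).

(* Reduces identities between vectors to scalar ones, within reach of [ring]. *)
Lemma inner_ext X (x y : X) : (forall z, inner x z = inner y z) -> x = y.
Proof.
move=> xy; apply/eqP; rewrite -subr_eq0 -normr_eq0 -sqrf_eq0 -inner_norm.
by rewrite innerBl xy subrr.
Qed.

Lemma norm_inner_le X (x y : X) : `|inner x y| <= `|x| * `|y|.
Proof.
rewrite ler_norml cauchy_schwarz andbT lerNl -innerNl.
by rewrite (le_trans (cauchy_schwarz _ _))// normrN.
Qed.

(** In a basis, each coordinate is a linear form represented by its Riesz vector, so Cauchy-Schwarz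
    bounds it by a multiple of [|x|]. The constant is raised to [M + 1] to be positive even when [f]
    vanishes. *)
Lemma linear_bounded X (V : normedModType R) (f : {linear X -> V}) :
  exists2 M : R, 0 < M & forall x, `|f x| <= M * `|x|.
Proof.
pose b := vbasis {: X}.
pose M : R := \sum_i `|riesz (coord b i : X -> R)| * `|f b`_i|.
have M0 : 0 <= M by apply: sumr_ge0 => i _; rewrite mulr_ge0.
exists (M + 1) => [|x]; first by rewrite ltr_wpDl.
rewrite mulrDl ler_wpDr ?mul1r// {1}(coord_vbasis (memvf x)) linear_sum.
rewrite (le_trans (ler_norm_sum _ _ _))// mulr_suml; apply: ler_sum => i _.
rewrite linearZ normrZ mulrAC ler_wpM2r//.
rewrite (rieszP (coord b i : {linear X -> R^o})); exact: norm_inner_le.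
Qed.

Lemma euclidean_linear_continuous X (V : normedModType R)
  (f : {linear X -> V}) : continuous f.
Proof.
apply/bounded_linear_continuous/bounded_funP => r.
have [M M0 fM] := linear_bounded f; exists (M * r) => x xr.
by rewrite (le_trans (fM x))// ler_wpM2l// ltW.
Qed.

(** * Compactness of balls and projections onto closed convex sets *)

Lemma closed_ball_norm (V : normedModType R) (x : V) (r : R) :
  0 < r -> closed_ball x r = [set y | `|x - y| <= r].
Proof. exact: closed_ballE. Qed.

(** Coordinates are bounded on the ball by Cauchy-Schwarz, so the ball is a closed subset of the
    continuous image of a compact box of coefficient vectors. *)
Lemma compact_closed_ball X (x : X) (r : R) : 0 < r ->
  compact (closed_ball x r).
Proof.
move=> r0; pose b := vbasis {: X}; pose n := \dim {: X}.
pose g (i : 'I_n) : X := riesz (coord b i : X -> R).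
pose B (i : 'I_n) := `[- (`|g i| * (`|x| + r)), `|g i| * (`|x| + r)]%classic.
pose F (c : 'rV[R]_n) : X := \sum_i c ord0 i *: b`_i.
have cF : continuous F.
  move=> c; apply: (@cvg_big _ _ _ _ _ _ _ _ _
    (fun i (d : 'rV[R]_n) => d ord0 i *: b`_i) _ (nbhs_filter c)) => [|i _].
    exact: add_continuous.
  apply: (@cvgZr_tmp _ _ _ _ (nbhs_filter c) (fun c => c ord0 i)).
  exact: coord_continuous.
have cB : compact [set c : 'rV[R]_n | forall i, B i (c ord0 i)].
  by apply: rV_compact => i; exact: segment_compact.
have cI := continuous_compact (continuous_subspaceT cF) cB.
apply: subclosed_compact cI _; first exact: closed_ball_closed.
rewrite closed_ball_norm// => y /= xy.
exists (\row_i coord b i y) => /=; last first.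
  rewrite /F [RHS](coord_vbasis (memvf y)); apply: eq_bigr => i _.
  by rewrite mxE.
move=> i; rewrite mxE /B /= in_itv/= -ler_norml.
rewrite (rieszP (coord b i : {linear X -> R^o})).
rewrite (le_trans (norm_inner_le _ _))// ler_wpM2l//.
by rewrite -[y](subKr x) (le_trans (ler_normB _ _))// lerD2l.
Qed.

(** The distance attains its minimum on the part of [C] in a ball around [x] large enough to contain
    one point of [C]; the points outside this ball are farther away. *)
Lemma closest_point X (C : set X) (x : X) : closed C -> C !=set0 ->
  exists2 p, C p & forall q, C q -> `|x - p| <= `|x - q|.
Proof.
move=> Cc [c Cc0]; pose r := `|x - c| + 1.
have r0 : 0 < r by rewrite ltr_wpDl.
have cK : compact (C `&` closed_ball x r).
  apply: (@subclosed_compact _ _ (closed_ball x r)).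
  - by apply: closedI => //; exact: closed_ball_closed.
  - exact: compact_closed_ball.
  - exact: subIsetr.
have cN : continuous (fun q : X => `|x - q|).
  move=> q; apply: cvg_norm; apply: cvgB; [exact: cvg_cst|exact: cvg_id].
have K0 : (C `&` closed_ball x r) !=set0.
  by exists c; split => //; rewrite closed_ball_norm//= lerDl.
have [p] := compact_EVT_min K0 cK (continuous_subspaceT cN).
rewrite inE => -[Cp pr] pmin; exists p => // q Cq.
have [qr|rq] := leP `|x - q| r; last first.
  by rewrite (le_trans _ (ltW rq))//; move: pr; rewrite closed_ball_norm.
by apply: pmin; rewrite inE; split => //; rewrite closed_ball_norm.
Qed.

Lemma closest_point_convex X (C : set X) (x p : X) :
  (forall (t : R) y z, 0 <= t <= 1 -> C y -> C z ->
     C (t *: y + (1 - t) *: z)) ->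
  C p -> (forall q, C q -> `|x - p| <= `|x - q|) ->
  forall q, C q -> inner (x - p) (q - p) <= 0.
Proof.
move=> Cconv Cp pmin q Cq; rewrite leNgt; apply/negP => a0.
set a := inner _ _ in a0; set b := `|q - p| ^+ 2.
have b0 : 0 <= b by rewrite sqr_ge0.
(* Moving from [p] towards [q] by [t] changes the squared distance to [x] by [t (t b - 2 a)], which
   is negative for this [t]. *)
pose t := a / (a + b + 1).
have d0 : 0 < a + b + 1 by lra.
have t0 : 0 < t by rewrite divr_gt0.
have t1 : t <= 1 by rewrite ler_pdivrMr// mul1r; lra.
have /pmin : C (t *: q + (1 - t) *: p) by apply: Cconv; rewrite ?(ltW t0).
have -> : x - (t *: q + (1 - t) *: p) = (x - p) + (- t) *: (q - p).
  by apply: inner_ext => z; rewrite !innerE; ring.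
rewrite -ler_sqr ?nnegrE// (inner_sqD (x - p)) innerZr normrZ exprMn -/a -/b.
rewrite -subr_ge0; apply/negP; rewrite -ltNge.
rewrite normrN gtr0_norm// mulNr mulr2n.
have -> : `|x - p| ^+ 2 + (- (t * a) - t * a) + t ^+ 2 * b - `|x - p| ^+ 2 =
   t * (t * b - 2 * a) by ring.
rewrite pmulr_rlt0// subr_lt0 /t mulrAC ltr_pdivrMr//.
rewrite -subr_gt0 (_ : _ - _ = a * (2 * a + b + 2)); last by ring.
by rewrite pmulr_rgt0//; lra.
Qed.

(** [d] is the projection of [x] on the cone. Testing the projection inequality at [d + d] and at
    [0] gives orthogonality, and then every test point gives the sign. *)
Lemma moreau X (T : set X) (x : X) : closed T -> T 0 ->
  (forall y z, T y -> T z -> T (y + z)) ->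
  (forall (t : R) y, 0 < t -> T y -> T (t *: y)) ->
  exists2 d, T d & inner (x - d) d = 0 /\
    forall e, T e -> inner (x - d) e <= 0.
Proof.
move=> Tc T0 TD TZ; have [d Td dmin] := closest_point x Tc (ex_intro _ 0 T0).
have TZ0 (t : R) y : 0 <= t -> T y -> T (t *: y).
  rewrite le_eqVlt => /predU1P[<-|t0]; last exact: TZ.
  by rewrite scale0r.
have Tconv (t : R) y z : 0 <= t <= 1 -> T y -> T z ->
    T (t *: y + (1 - t) *: z).
  by move=> /andP[? ?] Ty Tz; apply: TD; apply: TZ0; rewrite ?subr_ge0.
have key := closest_point_convex Tconv Td dmin.
have d0 : inner (x - d) d = 0.
  apply/eqP; rewrite eq_le; apply/andP; split.
    by have := key _ (TD _ _ Td Td); rewrite addrK.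
  by have := key _ T0; rewrite sub0r innerNr oppr_le0.
exists d => //; split=> // e Te.
by have := key _ Te; rewrite innerBr d0 subr0.
Qed.

End euclidean_basics.

(** * Differentials *)

Section differential.
Context {R : realType}.
Implicit Types (X V : euclideanType R).

Lemma diff_estimate (X V : normedModType R) (F : X -> V) (w : X) (e : R) :
  0 < e -> differentiable F w ->
  exists2 d : R, 0 < d & forall h, `|h| <= d ->
    `|F (w + h) - F w - 'd F w h| <= e * `|h|.
Proof.
move=> e0 /diff_locally/eqaddoP/(_ e e0)/nbhs_norm0P[d /= d0 dF].
exists (d / 2) => [|h hd]; first by rewrite divr_gt0.
have /dF : `|h| < d by rewrite (le_lt_trans hd)// ltr_pdivrMr// ltr_pMr// ltr1n.
by rewrite /= opprD addrA !fctE /= [h + w]addrC.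
Qed.

(** Pairing with [e] makes a curve in [V] scalar, so that the one-variable mean value theorem
    applies to it. *)
Lemma is_derive_line (X V : euclideanType R) (F : X -> V) (b h : X) (e : V)
  (t : R) : differentiable F (b + t *: h) ->
  is_derive t 1 (fun s : R => inner e (F (b + s *: h)))
    (inner e ('d F (b + t *: h) h)).
Proof.
move=> dF; pose g (s : R) : X := b + s *: h.
have dg : is_diff t g (fun s : R => s *: h).
  have -> : g = (cst b : R -> X) + ( *:%R^~ h) by [].
  by apply: is_diff_eq; rewrite add0r.
have dF' : is_diff (g t) F ('d F (g t)) by exact: differentiableP.
have dFg := is_diff_comp dg dF'.
have de : is_diff (F (g t)) (inner e : V -> R^o) (inner e).
  have ce := @euclidean_linear_continuous R V R^o (inner e).
  by apply: DiffDef; [exact: linear_differentiable|rewrite diff_lin].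
have dall := is_diff_comp dFg de.
have dd := @ex_diff _ _ _ _ _ _ _ dall.
have derf v := @diff_derivable _ _ _ _ _ v dd.
have derE v := @deriveE _ _ _ _ _ v dd.
split; first exact: derf.
rewrite [LHS]derE (@diff_val _ _ _ _ _ _ _ dall).
by rewrite /= scale1r.
Qed.

(** Pair [F] with the error vector [e] itself: the scalar mean value theorem yields
    [|e|^2 <= |e| c]. *)
Lemma mean_value_inequality (X V : euclideanType R) (F : X -> V) (b h : X)
    (v : V) (c : R) :
  (forall s : R, 0 <= s <= 1 -> differentiable F (b + s *: h) /\
     `|'d F (b + s *: h) h - v| <= c) ->
  `|F (b + h) - F b - v| <= c.
Proof.
move=> dF; set e := _ - v.
pose f (s : R) := inner e (F (b + s *: h)).
have df (s : R) : 0 <= s <= 1 -> is_derive s 1 f (inner e ('d F (b + s *: h) h)).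
  by move=> /dF[? _]; exact: is_derive_line.
have [||x] := @MVT R f (fun s => inner e ('d F (b + s *: h) h)) 0 1 ltr01.
- by move=> s; rewrite in_itv/= => /andP[? ?]; apply: df; rewrite !ltW.
- apply: continuous_in_subspaceT => s; rewrite inE/= in_itv/= => /df[ds _].
  exact/differentiable_continuous/derivable1_diffP.
rewrite in_itv/= => /andP[x0 x1].
rewrite /f scale0r addr0 scale1r subr0 mulr1 => fE.
have {}dF : `|'d F (b + x *: h) h - v| <= c by apply: (dF _ _).2; rewrite !ltW.
have [->|e0] := eqVneq e 0.
  by rewrite normr0 (le_trans _ dF).
rewrite -(ler_pM2l (_ : 0 < `|e|)) ?normr_gt0// -expr2 -inner_norm.
rewrite {2}/e innerBr innerBr fE -innerBr.
by rewrite (le_trans (cauchy_schwarz _ _))// ler_wpM2l.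
Qed.

(** Differentiability at [w] of [z |-> 'd F z b_i] gives the linear bound on each basis vector;
    expanding [h] in the basis turns these finitely many bounds into one for the operator. *)
Lemma diff_calm (X V : euclideanType R) (F : X -> V) (w : X) :
  twice_differentiable F w ->
  exists L : R, 0 < L /\ \forall z \near w, differentiable F z /\
    forall h, `|'d F z h - 'd F w h| <= L * `|z - w| * `|h|.
Proof.
move=> [dF d2F]; pose b := vbasis {: X}.
have /choice[L LP] (i : 'I_(\dim {: X})) : exists L : R, 0 <= L /\
    \forall z \near w, `|'d F z b`_i - 'd F w b`_i| <= L * `|z - w|.
  have [d d0 dP] := diff_estimate ltr01 (d2F b`_i).
  have [M M0 MP] := linear_bounded ('d (fun z => 'd F z b`_i) w).
  exists (1 + M); split; first by rewrite addr_ge0// ltW.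
  apply/nbhs_normP; exists d => //= z /=; rewrite distrC => /ltW/dP.
  rewrite (addrC w) subrK => H.
  set D := 'd (fun z => 'd F z b`_i) w (z - w) in H *.
  have -> : 'd F z b`_i - 'd F w b`_i = ('d F z b`_i - 'd F w b`_i - D) + D.
    by rewrite subrK.
  by rewrite (le_trans (ler_normD _ _))// mulrDl; apply: lerD => //; exact: MP.
pose S := \sum_i L i * `|riesz (coord b i : X -> R)|.
have S0 : 0 <= S by apply: sumr_ge0 => i _; rewrite mulr_ge0// (LP i).1.
exists (1 + S); split; first by rewrite ltr_wpDr.
have : \forall z \near w, forall i : 'I_(\dim {: X}),
    `|'d F z b`_i - 'd F w b`_i| <= L i * `|z - w|.
  by apply: filter_forall => i; exact: (LP i).2.
apply: filterS2 dF => z dFz Lz; split=> // h.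
rewrite mulrDl mul1r mulrDl ler_wpDl ?mulr_ge0//.
rewrite [h in X in X <= _](coord_vbasis (memvf h)) !linear_sum -big_split /=.
rewrite (le_trans (ler_norm_sum _ _ _))// /S !mulr_suml.
apply: ler_sum => i _; rewrite !linearZ -/b -scalerDr normrZ mulrC.
rewrite -[leRHS]mulrA mulrACA; apply: ler_pM => //.
rewrite (rieszP (coord b i : {linear X -> R^o})); exact: norm_inner_le.
Qed.

End differential.

(** * The Lyusternik theorem *)

Section lyusternik.
Context {R : realType}.

(* By minimality, [phi z] cannot displace less than the minimizer [z] of the
   displacement, so that the displacement at [z] is null. *)
Lemma ball_contraction_fixed_point (V : euclideanType R) (r : R) (phi : V -> V) :
  0 < r ->
  (forall y z, `|y| <= r -> `|z| <= r -> `|phi y - phi z| <= 2^-1 * `|y - z|) ->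
  (forall z, `|z| <= r -> `|phi z| <= r) ->
  exists2 z, `|z| <= r & phi z = z.
Proof.
move=> r0 phic phir; pose B := closed_ball (0 : V) r.
have BE z : B z <-> `|z| <= r.
  by rewrite /B closed_ball_norm//= sub0r normrN.
have cf : {within B, continuous (fun z => `|phi z - z|)}.
  apply/subspace_continuousP => z /BE zr; apply/cvgrPdist_lt => e e0.
  rewrite near_withinE; near=> y => /BE yr.
  rewrite (le_lt_trans (ler_dist_dist _ _))//.
  have -> : phi z - z - (phi y - y) = (phi z - phi y) - (z - y).
    by apply: inner_ext => x; rewrite !innerE; ring.
  rewrite (le_lt_trans (ler_normB _ _))//.
  rewrite (@le_lt_trans _ _ (2 * `|z - y|))//.
    by have := phic z y zr yr; have := normr_ge0 (z - y); lra.
  rewrite -ltr_pdivlMl//; near: y; apply: cvgr_dist_lt => //.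
  by rewrite mulr_gt0// invr_gt0.
have B0 : B !=set0 by exists 0; apply/BE; rewrite normr0 ltW.
have [z] := compact_EVT_min B0 (compact_closed_ball (x := 0 : V) r0) cf.
rewrite inE => /BE zr zmin; exists z => //.
have pz := phir _ zr.
have := zmin (phi z); rewrite inE => /(_ ((BE _).2 pz)) => H.
have := phic _ _ pz zr => H2; apply/eqP; rewrite -subr_eq0 -normr_le0.
by have := le_trans H H2; lra.
Unshelve. all: by end_near. Qed.

(** [Q] inverts [G] on the range of [G], which is the form used below both for a surjective
    differential and for a linear map restricted to a subspace. *)
Lemma linear_right_inverse (X V : euclideanType R) (G : {linear X -> V}) :
  exists q : R, 0 < q /\ exists Q : {linear V -> X},
    (forall z, `|Q z| <= q * `|z|) /\ forall h, G (Q (G h)) = G h.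
Proof.
pose f := linfun G; pose Q : {linear V -> X} := (f^-1)%VF.
have [q q0 qP] := linear_bounded Q.
exists q; split => //; exists Q; split=> // h.
have -> : G h = f h by rewrite lfunE.
by rewrite -[G _](lfunE G) /Q limg_lfunVK ?memv_img ?memvf.
Qed.

(** The solution is sought as [w + h + Q z], with [Q] a right inverse of the differential, which
    makes [z] a fixed point of [phi]. Near [w] the map [F] is close to its linearization, so [phi]
    contracts a ball of radius of order [|h|^2]. *)
Lemma lyusternik (X V : euclideanType R) (F : X -> V) (w : X) :
  twice_differentiable F w -> (forall v, exists h, 'd F w h = v) ->
  exists d M : R, [/\ 0 < d, 0 < M & forall h, `|h| <= d ->
    exists2 z, F z = F w + 'd F w h & `|z - w - h| <= M * `|h| ^+ 2].
Proof.
move=> d2F Fonto; have [L [L0 /nbhs_normP[e /= e0 LP]]] := diff_calm d2F.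
have [q [q0 [Q [Qq GQG]]]] := linear_right_inverse ('d F w).
have GQ v : 'd F w (Q v) = v by have [h <-] := Fonto v; exact: GQG.
have key (a b : X) (rho : R) : rho < e -> `|a - w| <= rho -> `|b - w| <= rho ->
    `|F a - F b - 'd F w (a - b)| <= L * rho * `|a - b|.
  move=> re ar br; have {1}-> : a = b + (a - b) by rewrite addrC subrK.
  apply: mean_value_inequality => s /andP[s0 s1].
  have bs : `|(b + s *: (a - b)) - w| <= rho.
    have -> : b + s *: (a - b) - w = s *: (a - w) + (1 - s) *: (b - w).
      by apply: inner_ext => x; rewrite !innerE; ring.
    rewrite (le_trans (ler_normD _ _))// !normrZ !ger0_norm ?subr_ge0//.
    have : s * `|a - w| <= s * rho by rewrite ler_wpM2l.
    have : (1 - s) * `|b - w| <= (1 - s) * rho by rewrite ler_wpM2l// subr_ge0.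
    by lra.
  have /LP[dF dFL] : ball_ Num.norm w e (b + s *: (a - b)).
    by rewrite /ball_/= distrC (le_lt_trans bs).
  split=> //; rewrite (le_trans (dFL _))// ler_wpM2r// ler_wpM2l//.
  exact: ltW.
(* The first bound keeps [2 |h|] below [e]; the second gives [4 L q |h| <= 1], which makes the
   contraction factor one half. *)
pose d := Num.min (e / 3) (4 * L * q)^-1.
have Lq0 : 0 < 4 * L * q by rewrite !mulr_gt0.
have d0 : 0 < d by rewrite lt_min divr_gt0//= invr_gt0.
exists d, (q * (2 * L)); split; rewrite ?mulr_gt0// => h; rewrite le_min.
move=> /andP[he hLq].
have [->|h0] := eqVneq h 0.
  exists w; first by rewrite linear0 addr0.
  by rewrite subrr subr0 normr0 expr0n mulr0.
have {}h0 : 0 < `|h| by rewrite normr_gt0.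
(* The linearization error gives [|phi 0| <= L |h|^2], half of [s]; the contraction contributes at
   most the other half. *)
set s := 2 * L * `|h| ^+ 2; have s0 : 0 < s by rewrite !mulr_gt0// exprn_gt0.
have hq : 4 * L * q * `|h| <= 1.
  by rewrite -ler_pdivlMl// mulr1.
pose pt (z : V) := w + h + Q z.
pose phi (z : V) := z - F (pt z) + (F w + 'd F w h).
have ptr z : `|z| <= s -> `|pt z - w| <= 2 * `|h|.
  move=> zs; have -> : pt z - w = h + Q z.
    by apply: inner_ext => x; rewrite !innerE; ring.
  rewrite (le_trans (ler_normD _ _))// mulr2n mulrDl mul1r lerD2l.
  rewrite (le_trans (Qq _))// (@le_trans _ _ (q * s))//.
    by rewrite ler_wpM2l// ltW.
  rewrite /s; have -> : q * (2 * L * `|h| ^+ 2) =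
    (4 * L * q * `|h|) * (`|h| / 2) by field.
  by rewrite (@le_trans _ _ (1 * (`|h| / 2)))// ?ler_wpM2r//; lra.
have h2e : 2 * `|h| < e by move: he; rewrite ler_pdivlMr//; lra.
have phic y z : `|y| <= s -> `|z| <= s ->
    `|phi y - phi z| <= 2^-1 * `|y - z|.
  move=> ys zs; have := key _ _ _ h2e (ptr _ ys) (ptr _ zs).
  have -> : pt y - pt z = Q (y - z).
    by rewrite /pt linearB; apply: inner_ext => x; rewrite !innerE; ring.
  rewrite GQ => H; rewrite distrC.
  have -> : phi z - phi y = F (pt y) - F (pt z) - (y - z).
    by rewrite /phi; apply: inner_ext => x; rewrite !innerE; ring.
  rewrite (le_trans H)//.
  rewrite (@le_trans _ _ (L * (2 * `|h|) * (q * `|y - z|)))//.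
    by rewrite ler_wpM2l// !mulr_ge0// ltW.
  have -> : L * (2 * `|h|) * (q * `|y - z|) =
      (4 * L * q * `|h|) * (2^-1 * `|y - z|) by field.
  by rewrite -[leRHS]mul1r ler_wpM2r// mulr_ge0.
have phir z : `|z| <= s -> `|phi z| <= s.
  move=> zs; have n0 : `|0 : V| <= s by rewrite normr0 ltW.
  have := phic _ _ zs n0; rewrite subr0 => H1.
  have := key (w + h) w `|h|; rewrite subrr normr0.
  have -> : w + h - w = h by rewrite addrC addKr.
  have he' : `|h| < e by lra.
  move=> /(_ he' (lexx _) (ltW h0)) H2.
  have -> : phi z = (phi z - phi 0) - (F (w + h) - F w - 'd F w h).
    rewrite {3}/phi /pt linear0 addr0.
    by apply: inner_ext => x; rewrite !innerE; ring.
  rewrite (le_trans (ler_normB _ _))//.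
  have -> : s = 2^-1 * s + L * `|h| * `|h| by rewrite /s; field.
  apply: lerD => //; rewrite (le_trans H1)// ler_wpM2l// invr_ge0//.
have [z zs zfix] := ball_contraction_fixed_point s0 phic phir.
exists (pt z).
  move: zfix => /eqP; rewrite /phi -subr_eq0 => /eqP zfix.
  apply/esym/eqP; rewrite -subr_eq0; apply/eqP; rewrite -[RHS]zfix.
  by apply: inner_ext => x; rewrite !innerE; ring.
have -> : pt z - w - h = Q z.
  by apply: inner_ext => x; rewrite !innerE; ring.
rewrite (le_trans (Qq _))// -mulrA ler_wpM2l//; exact: ltW.
Qed.

End lyusternik.

(** * Gauges and polars *)

Section gauges.
Context {R : realType} {X : euclideanType R}.
Implicit Types (g h : X -> \bar R) (w z : X).

Lemma hprod_innerE (Y Z : euclideanType R) (p q : hprod Y Z) :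
  inner p q = inner p.1 q.1 + inner p.2 q.2.
Proof. by []. Qed.

Lemma hprod_norm_fst (Y Z : euclideanType R) (p : hprod Y Z) : `|p.1| <= `|p|.
Proof.
by rewrite -ler_sqr ?nnegrE// -!inner_norm hprod_innerE lerDl inner_norm sqr_ge0.
Qed.

Lemma hprod_norm_snd (Y Z : euclideanType R) (p : hprod Y Z) : `|p.2| <= `|p|.
Proof.
by rewrite -ler_sqr ?nnegrE// -!inner_norm hprod_innerE lerDr inner_norm sqr_ge0.
Qed.

(** If [p] were in the closure but below the graph, a level [a] strictly between [p.2] and [h p.1]
    would stay below [h] near [p.1], and above the heights of the points near [p]. *)
Lemma closed_epigraph h : lower_semicontinuous h -> closed (epigraph h).
Proof.
move=> hlsc p clp; rewrite /epigraph /= leNgt; apply/negP => hp.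
have [a pa ah] : exists2 a, p.2 < a & (a%:E < h p.1)%E.
  case: (h p.1) hp => [r| |//]; last by exists (p.2 + 1); rewrite ?ltrDl ?ltry.
  by rewrite lte_fin => pr; exists ((p.2 + r) / 2); rewrite ?lte_fin; lra.
have [U /nbhs_normP[e /= e0 eU] Uh] := hlsc _ _ ah.
have m0 : 0 < Num.min e (a - p.2) by rewrite lt_min e0 subr_gt0.
have [q [/= Eq]] := clp _ (nbhsx_ballx p _ m0).
rewrite -ball_normE /ball_/= lt_min => /andP[qe qa].
have /eU/Uh : `|p.1 - q.1| < e.
  exact: le_lt_trans (hprod_norm_fst (p - q)) qe.
rewrite ltNge => /negP; apply; apply: (le_trans Eq); rewrite lee_fin.
have := le_lt_trans (hprod_norm_snd (p - q)) qa.
rewrite ltr_norml => /andP[+ _]; rewrite /=; lra.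
Qed.

Lemma polar_leP g w (t : R) :
  (polar g w <= t%:E)%E <-> forall z, (g z <= 1)%E -> inner w z <= t.
Proof.
split=> [H z gz|H].
  by rewrite -lee_fin (le_trans _ H)//; apply: ereal_sup_ubound; exists z.
by apply: ge_ereal_sup => _ [z gz <-]; rewrite lee_fin; exact: H.
Qed.

Lemma polar_scale_le g w (s t : R) : 0 < s ->
  (polar g w <= t%:E)%E -> (polar g (s *: w)%R <= (s * t)%:E)%E.
Proof.
move=> s0 /polar_leP wt; apply/polar_leP => z gz.
by rewrite innerZl ler_pM2l// wt.
Qed.

Lemma polar_le_convex g w w' (s t t' : R) : 0 <= s <= 1 ->
  (polar g w <= t%:E)%E -> (polar g w' <= t'%:E)%E ->
  (polar g (s *: w + (1 - s) *: w')%R <= (s * t + (1 - s) * t')%:E)%E.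
Proof.
move=> /andP[s0 s1] /polar_leP wt /polar_leP wt'; apply/polar_leP => z gz.
by rewrite innerDl !innerZl lerD// ler_wpM2l ?subr_ge0 ?wt ?wt'.
Qed.

Lemma polar_ge0 g w : gauge g -> (0 <= polar g w)%E.
Proof.
move=> [_ _ _ g0]; apply: ereal_sup_ubound; exists 0.
  by rewrite /= g0.
by rewrite inner0r.
Qed.

(** Each [z] with [g z = r] is scaled by [1 / (r + e)] into the unit level set; the margin [e],
    which then tends to 0, covers the case [r = 0]. *)
Lemma polar_le1P g w : gauge g ->
  (polar g w <= 1)%E <-> forall z, ((inner w z)%:E <= g z)%E.
Proof.
move=> [_ gge0 gZ _]; split=> [|H]; last first.
  by apply/(polar_leP g w 1) => z gz; rewrite -lee_fin (le_trans (H z)).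
move=> /(polar_leP g w 1) H z.
case gz : (g z) (gge0 z) => [r| |//]; last by rewrite !leey.
rewrite !lee_fin => r0; apply/ler_addgt0Pr => e e0.
have re0 : 0 < r + e by rewrite ltr_wpDl.
have := H ((r + e)^-1 *: z); rewrite innerZr gZ ?invr_gt0// gz -EFinM lee_fin.
rewrite ler_pdivrMl// mulr1 lerDl (ltW e0) => /(_ isT).
by rewrite ler_pdivrMl// mulr1.
Qed.

(** Convexity at the midpoint of [2 y] and [2 z], followed by homogeneity. *)
Lemma gauge_subadd g y z (s t : R) : gauge g -> (g y <= s%:E)%E ->
  (g z <= t%:E)%E -> (g (y + z)%R <= (s + t)%:E)%E.
Proof.
move=> [gc _ gZ _] ys zt.
have h01 : 0 <= (2^-1 : R) <= 1 by lra.
have := gc (2%:R *: y) (2%:R *: z) _ h01.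
have -> : 2^-1 *: (2%:R *: y) + (1 - 2^-1) *: (2%:R *: z) = y + z.
  by apply: inner_ext => x; rewrite !innerE; field.
move=> /le_trans; apply; rewrite !gZ// !muleA -!EFinM EFinD.
have -> : 2^-1 * 2%:R = 1 :> R by field.
have -> : (1 - 2^-1) * 2%:R = 1 :> R by field.
by rewrite !mul1e; apply: leeD.
Qed.

(* A weak form of the bipolar theorem. *)
Lemma gauge_le_of_polar g n u : gauge g -> lower_semicontinuous g ->
  (polar g u <= 1)%E ->
  (forall w, (polar g w <= 1)%E -> inner w n <= inner u n) ->
  (g n <= (inner u n)%:E)%E.
Proof.
move=> gg glsc pu un; have [gc gge0 gZ g0] := gg.
rewrite leNgt; apply/negP => ungn; set s := inner u n in un ungn.
(* The epigraph is a closed convex cone, and [p] lies outside it by assumption: its Moreau residual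
   [p - d] separates the two. *)
pose E := epigraph g; pose p : hprod X R^o := (n, s).
have [d Ed [pd dE]] : exists2 d, E d & inner (p - d) d = 0 /\
    forall e, E e -> inner (p - d) e <= 0.
  apply: moreau.
  - exact: closed_epigraph.
  - by rewrite /E /epigraph/= g0.
  - by move=> y z Ey Ez; apply: gauge_subadd.
  - by move=> t y t0 Ey; rewrite /E /epigraph/= gZ// EFinM lee_pmul2l.
have pd0 : 0 < inner (p - d) p.
  rewrite -[X in inner _ X](subrK d) innerDr pd addr0 inner_norm exprn_gt0//.
  rewrite normr_gt0 subr_eq0; apply/eqP => pdE.
  by move: Ed; rewrite -pdE /E /epigraph /= leNgt ungn.
set al := (p - d).1; set be := (p - d).2.
have be0 : be <= 0.
  have : E (0, 1) by rewrite /E /epigraph/= g0 lee01.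
  move=> /dE; rewrite hprod_innerE inner0r add0r => H.
  by rewrite -[be]mulr1; exact: H.
have b1 : 0 < 1 - be by lra.
(* Dividing [al] by [- be] would fail for a vertical hyperplane, where [be = 0]. Averaging with the
   feasible [u] replaces the divisor by [1 - be > 0]. *)
have : (polar g ((1 - be)^-1 *: (al + u))%R <= 1)%E.
  apply/polar_le1P => // z.
  have := (polar_le1P u gg).1 pu z.
  case gz : (g z) (gge0 z) => [r| |//]; last by rewrite !leey.
  rewrite !lee_fin => r0 uz; rewrite innerZl ler_pdivrMl// innerDl.
  have : E (z, r) by rewrite /E /epigraph/= gz.
  move=> /dE; rewrite hprod_innerE /= -/al => H.
  have : inner al z + be * r <= 0 by exact: H.
  by lra.
move=> /un; rewrite innerZl ler_pdivrMl// innerDl => H.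
have : 0 < inner al n + be * s by exact: pd0.
by rewrite /s in H *; lra.
Qed.

End gauges.

(** * Second-order tangent cones *)

Section tangent_cone.
Context {R : realType}.

Lemma convex_setP (V : lmodType R) (K : set V) : convex_set K <->
  forall (t : R) y z, 0 <= t <= 1 -> K y -> K z -> K (t *: y + (1 - t) *: z).
Proof.
split=> [Kc t y z /andP[t0 t1] Ky Kz|Kc y z t].
  have := Kc y z (Itv01 t0 t1); rewrite !inE => /(_ Ky Kz).
  by rewrite /conv/=.
rewrite !inE => Ky Kz; apply: (Kc t%:num y z) => //.
by apply/andP; split.
Qed.

Lemma closed_approx (V : normedModType R) (K : set V) x : closed K ->
  (forall e : R, 0 < e -> exists2 y, K y & `|x - y| < e) -> K x.
Proof.
move=> Kc H; apply: Kc => B /nbhs_normP[e /= e0 eB].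
by have [y Ky xy] := H _ e0; exists y; split => //; apply: eB.
Qed.

Variable X : euclideanType R.
Implicit Types (C T : set X) (u : X).

(* [T] is the tangent cone to [C] at [u], with a quadratic bound on the error
   made by following a tangent direction rather than [C]. *)
Definition second_order_tangent C T u : Prop :=
  [/\ closed T, T 0, forall y z, T y -> T z -> T (y + z),
      forall (t : R) y, 0 < t -> T y -> T (t *: y) &
      (forall w, C w -> T (w - u)) /\
      exists e M : R, [/\ 0 < e, 0 < M & forall d, T d -> `|d| <= e ->
        exists2 w, C w & `|w - u - d| <= M * `|d| ^+ 2] ].

Lemma hprod_norm0r (Y Z : euclideanType R) (y : Y) :
  `|(y, 0) : hprod Y Z| = `|y|.
Proof.
apply/eqP; rewrite -(eqrXn2 (n := 2))// -!inner_norm hprod_innerE /=.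
by rewrite inner0l addr0.
Qed.

(** The epigraph is reduced at its point [(u, 1)]. A direction [d] belongs to [T] when the
    differential of the reduction maps the horizontal vector [(d, 0)] into [K]. *)
Lemma reducible_second_order_tangent (g : X -> \bar R) u : gauge g ->
  C2_cone_reducible (polar g) -> polar g u = 1%E ->
  exists T, second_order_tangent [set w | (polar g w <= 1)%E] T u.
Proof.
move=> gg [_ red] gu; pose w0 : hprod X R^o := (u, 1).
have Ew0 : epigraph (polar g) w0 by rewrite /epigraph/= gu.
have [V [K [rho [F [[Kc Kconv Kcone Kp] [rho0 Fw0] [d2F _] Fonto EF]]]]] :=
  red w0 Ew0.
have {}d2F : twice_differentiable F w0 by apply: d2F; exact: closed_ballxx.
have dF : differentiable F w0 by have := nbhs_singleton d2F.1.
have EK z : `|w0 - z| <= rho -> epigraph (polar g) z <-> K (F z).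
  move=> zrho; have zB : closed_ball w0 rho z by rewrite closed_ball_norm.
  split=> H.
    have : (epigraph (polar g) `&` closed_ball w0 rho) z by split.
    by rewrite EF => -[].
  have : ([set w | K (F w)] `&` closed_ball w0 rho) z by split.
  by rewrite -EF => -[].
have K0 : K 0 by have : [set (0 : V)] 0 := erefl; rewrite -Kp => -[].
have KD y z : K y -> K z -> K (y + z).
  move=> Ky Kz; have -> : y + z = 2%:R *: (2^-1 *: y + (1 - 2^-1) *: z).
    by apply: inner_ext => x; rewrite !innerE; field.
  by apply: Kcone => //; apply: (convex_setP K).1 => //; lra.
pose B (d : X) := 'd F w0 ((d, 0) : hprod X R^o).
have Bl : linear B.
  move=> a y z; rewrite /B -linearP; congr ('d F w0 _).
  by congr pair => /=; rewrite scaler0 addr0.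
pose BL : {linear X -> V} := HB.pack B (GRing.isLinear.Build _ _ _ _ B Bl).
have Bc : continuous B := @euclidean_linear_continuous R X V BL.
have B0 : B 0 = 0 := linear0 BL.
have BD y z : B (y + z) = B y + B z := linearD BL y z.
have BZ t y : B (t *: y) = t *: B y by have := Bl t y 0; rewrite B0 !addr0.
exists [set d | K (B d)]; split => /=.
- by apply: preimage_closed => // x _; exact: Bc.
- by rewrite B0.
- by move=> y z Ky Kz; rewrite BD; exact: KD.
- by move=> t y t0 Ky; rewrite BZ; exact: Kcone.
split.
  (* By convexity the segment from [(u, 1)] to [(w, 1)] stays in the epigraph, so [F] maps it into
     [K] near [w0]; its difference quotients lie in [K] and approach the differential. *)
  move=> w Cw; apply: closed_approx => // e e0.
  pose D : hprod X R^o := (w - u, 0); rewrite -[B _]/('d F w0 D).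
  have [->|D0] := eqVneq D 0.
    by exists 0 => //; rewrite linear0 subrr normr0.
  have nD : 0 < `|D| by rewrite normr_gt0.
  have e1 : 0 < e / (2 * `|D|) by rewrite divr_gt0// mulr_gt0.
  have [d d0 dP] := diff_estimate e1 dF.
  pose s := Num.min 1 (Num.min (d / `|D|) (rho / `|D|)).
  have s0 : 0 < s by rewrite !lt_min ltr01 !divr_gt0.
  have [s1 sd srho] : [/\ s <= 1, s * `|D| <= d & s * `|D| <= rho].
    by split; rewrite -?ler_pdivlMr// /s !ge_min lexx ?orbT.
  have nsD : `|s *: D| = s * `|D| by rewrite normrZ gtr0_norm.
  have : K (F (w0 + s *: D)).
    apply/EK; first by rewrite opprD addrA subrr sub0r normrN nsD.
    have := @polar_le_convex R X g w u s 1 1; rewrite (ltW s0) s1 Cw gu lexx.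
    move=> /(_ isT isT isT); rewrite /epigraph /=; congr (_ <= _)%E.
      by congr (polar g _); apply: inner_ext => x; rewrite !innerE; ring.
    by congr EFin; rewrite scaler0; ring.
  move=> KF; exists (s^-1 *: F (w0 + s *: D)).
    by apply: Kcone => //; rewrite invr_gt0.
  have := dP (s *: D); rewrite nsD => /(_ sd); rewrite Fw0 subr0 linearZ => H.
  have -> : 'd F w0 D - s^-1 *: F (w0 + s *: D) =
      - (s^-1 *: (F (w0 + s *: D) - s *: 'd F w0 D)).
    apply: inner_ext => x; rewrite !innerE.
    by field; rewrite gt_eqF.
  rewrite normrN normrZ gtr0_norm ?invr_gt0// ltr_pdivrMl//.
  rewrite (le_lt_trans H)// mulrCA ltr_pM2l//.
  have -> : e / (2 * `|D|) * `|D| = e / 2 by field; rewrite gt_eqF.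
  by lra.
have [d [M [d0 M0 dM]]] := lyusternik d2F Fonto.
(* The bound [rho / (1 + M)] keeps the Lyusternik point [z] in the reduction ball, and [1 / (2 M)]
   keeps its height [t] above one half. *)
pose e := Num.min (Num.min 1 d) (Num.min (rho / (1 + M)) (2 * M)^-1).
have e0 : 0 < e.
  by rewrite !lt_min ltr01 d0 divr_gt0 ?addr_gt0//= invr_gt0 mulr_gt0.
exists e, (2 * M * (`|u| + 2)); split=> //.
  by rewrite !mulr_gt0// ltr_wpDl.
move=> x Kx; rewrite !le_min -andbA => /and4P[x1 xd xrho xM].
pose D : hprod X R^o := (x, 0).
have nD : `|D| = `|x| by exact: hprod_norm0r.
have := dM D; rewrite nD => /(_ xd)[z]; rewrite Fw0 add0r => Fz zD.
have x2 : `|x| ^+ 2 <= `|x| by rewrite expr2 ler_piMl.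
have Mx2 : M * `|x| ^+ 2 <= M * `|x| by rewrite ler_wpM2l// ltW.
have Ez : epigraph (polar g) z.
  apply/EK; last by rewrite Fz.
  have -> : w0 - z = - (D + (z - w0 - D)).
    by apply: inner_ext => y; rewrite !innerE; ring.
  rewrite normrN (le_trans (ler_normD _ _))// nD.
  by move: xrho; rewrite ler_pdivlMr ?addr_gt0//; lra.
pose t : R := z.2.
have t1 : `|t - 1| <= M * `|x| ^+ 2.
  apply: le_trans zD; apply: le_trans (hprod_norm_snd _).
  by rewrite /= subr0.
have z1 : `|z.1 - u - x| <= M * `|x| ^+ 2.
  by apply: le_trans zD; apply: le_trans (hprod_norm_fst _).
have xM2 : M * `|x| <= 2^-1.
  by move: xM; rewrite invfM ler_pdivlMr// mulrC.
have t2 : 2^-1 <= t.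
  by move: t1; rewrite ler_norml => /andP[? _]; lra.
have t0 : 0 < t by lra.
have ti : t^-1 <= 2.
  by rewrite -[leRHS]invrK lef_pV2// posrE.
(* [z] is in the epigraph at a height [t] which may exceed 1; dividing by [t] returns to level 1
   and, as [t - 1] is of order [|x|^2], costs only a quadratic error. *)
exists (t^-1 *: z.1).
  have : (polar g z.1 <= t%:E)%E by exact: Ez.
  move=> /(polar_scale_le (s := t^-1)); rewrite invr_gt0 => /(_ t0).
  by rewrite mulVf// gt_eqF.
have -> : t^-1 *: z.1 - u - x =
    t^-1 *: (z.1 - u - x) - ((t - 1) / t) *: (u + x).
  by apply: inner_ext => y; rewrite !innerE; field; rewrite gt_eqF.
rewrite (le_trans (ler_normB _ _))// !normrZ !(@gtr0_norm _ t^-1) ?invr_gt0//.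
have -> : 2 * M * (`|u| + 2) * `|x| ^+ 2 =
   2 * (M * `|x| ^+ 2) + (M * `|x| ^+ 2 * 2) * (`|u| + 1) by ring.
apply: lerD; first by apply: ler_pM; rewrite ?invr_ge0 ?(ltW t0).
apply: ler_pM => //; first by rewrite mulr_ge0// invr_ge0 ltW.
  by apply: ler_pM; rewrite ?invr_ge0 ?(ltW t0).
by rewrite (le_trans (ler_normD _ _))// lerD2l.
Qed.

End tangent_cone.

(** * Normal cones and linear regularity *)

Section normal_cone.
Context {R : realType} {X : euclideanType R}.
Implicit Types (T N : set X) (u : X).

Definition polar_cone T : set X := [set n | forall d, T d -> inner n d <= 0].

Variables (g : X -> \bar R) (u : X) (T : set X).
Hypotheses (gg : gauge g) (gu : polar g u = 1%E).
Hypothesis CT : second_order_tangent [set w | (polar g w <= 1)%E] T u.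

Let sub_T w : (polar g w <= 1)%E -> T (w - u).
Proof. by case: CT => _ _ _ _ [+ _]; apply. Qed.

(** Testing a subgradient at [2 u] and [0] gives [<n,u> = 1] by homogeneity; testing it along the
    points of the level set that follow [u + t d] shows that it is normal. Conversely, any [w] is
    scaled into the level set, with a margin [f] in case its polar value is 0. *)
Lemma subdiff_polarP n :
  subdiff (polar g) u n <-> polar_cone T n /\ inner n u = 1.
Proof.
case: CT => _ _ _ _ [_ [e [M [e0 M0 CTe]]]].
split=> [[_ sn]|[Nn nu]]; last first.
  split; first by rewrite /edom/= gu ltry.
  move=> w; rewrite gu innerBr nu.
  case gw : (polar g w) (polar_ge0 w gg) => [t| |//]; last by rewrite !leey.
  rewrite -EFinD !lee_fin => t0; rewrite addrC subrK.
  apply/ler_addgt0Pr => f f0; have tf : 0 < t + f by lra.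
  have /sub_T/Nn : (polar g ((t + f)^-1 *: w)%R <= 1)%E.
    apply: le_trans (_ : (((t + f)^-1 * t)%:E <= 1)%E).
      by apply: polar_scale_le; rewrite ?invr_gt0// gw.
    by rewrite lee_fin ler_pdivrMl// mulr1; lra.
  by rewrite innerBr nu innerZr subr_le0 ler_pdivrMl// mulr1.
split; last first.
  have s0 : polar g 0 = 0%E.
    apply/eqP; rewrite eq_le polar_ge0// andbT.
    by apply/polar_leP => z _; rewrite inner0l.
  apply/eqP; rewrite eq_le; apply/andP; split.
    have := sn (2%:R *: u); have : (polar g (2%:R *: u)%R <= (2%:R * 1)%:E)%E.
      by apply: polar_scale_le; rewrite ?gu.
    move=> /[swap] /le_trans /[apply]; rewrite gu -EFinD lee_fin.
    by rewrite innerBr innerZr; lra.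
  have := sn 0; rewrite s0 gu sub0r innerNr -EFinD lee_fin; lra.
move=> d Td; rewrite leNgt; apply/negP => nd0.
pose B := `|n| * M * `|d| ^+ 2.
have B0 : 0 <= B by rewrite !mulr_ge0// ?sqr_ge0// ltW.
(* [t] is small enough for the quadratic bound to apply to [t d], and for its error [t^2 B] to stay
   below the gain [t <n,d>]. *)
pose t := Num.min (e / (`|d| + 1)) (inner n d / (2 * (B + 1))).
have d1 : 0 < `|d| + 1 by rewrite ltr_wpDl.
have t0 : 0 < t by rewrite lt_min !divr_gt0// mulr_gt0// ltr_wpDl.
have te : t * `|d| <= e.
  rewrite (@le_trans _ _ (t * (`|d| + 1)))//.
    by rewrite ler_wpM2l ?lerDl// ltW.
  by rewrite -ler_pdivlMr// ge_min lexx.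
have tB : t * B < inner n d.
  rewrite (@lt_le_trans _ _ (t * (2 * (B + 1))))//.
    by rewrite ltr_pM2l//; lra.
  by rewrite -ler_pdivlMr ?mulr_gt0 ?ltr_wpDl// ge_min lexx orbT.
have Ttd : T (t *: d) by case: CT => _ _ _ TZ _; apply: TZ.
have := CTe _ Ttd; rewrite normrZ gtr0_norm// => /(_ te)[w /= Cw wu].
have nw : inner n (w - u) <= 0.
  by have := le_trans (sn w) Cw; rewrite gu -EFinD lee_fin; lra.
have : - inner n (w - u - t *: d) <= `|n| * (M * (t * `|d|) ^+ 2).
  by rewrite -innerNr (le_trans (cauchy_schwarz _ _))// normrN ler_wpM2l.
rewrite (innerBr n (w - u)) innerZr.
have -> : `|n| * (M * (t * `|d|) ^+ 2) = t * (t * B) by rewrite /B; ring.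
have : t * (t * B) < t * inner n d by rewrite ltr_pM2l.
lra.
Qed.

(** The origin is in the level set, so [- u] is a tangent direction. *)
Lemma polar_cone_inner_ge0 n : polar_cone T n -> 0 <= inner n u.
Proof.
have /sub_T : (polar g 0%R <= 1)%E.
  by apply/(polar_leP g 0 1) => z _; rewrite inner0l.
by rewrite sub0r => Tu /(_ _ Tu); rewrite innerNr oppr_le0.
Qed.

(** Normality says that [u] maximizes [<.,n>] over the level set of the polar, and the bipolar bound
    applies. *)
Lemma gauge_polar_cone n : lower_semicontinuous g -> polar_cone T n ->
  (g n <= (inner u n)%:E)%E.
Proof.
move=> glsc Nn; apply: gauge_le_of_polar => //; first by rewrite gu.
by move=> w /sub_T/Nn; rewrite innerC innerBl subr_le0.
Qed.

(* Moreau's decomposition [x = n + d] along the polar cone and [T]; the dual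
   points [w ~ u + t d] then bound [g x] from below by [<u,x> + t |d|^2 / 2]. *)
Lemma gauge_quadratic_growth (rho : R) : 0 < rho ->
  exists2 c : R, 0 < c & forall x, `|x| <= rho -> exists n,
    [/\ polar_cone T n, `|n| <= rho &
        ((inner u x + c * `|x - n| ^+ 2)%:E <= g x)%E].
Proof.
move=> rho0; case: CT => Tc T0 TD TZ [_ [e [M [e0 M0 CTe]]]].
(* The first bound makes [t d] admissible; the second makes the error, at most [M |t d|^2 rho], no
   more than half of the gain [t |d|^2]. *)
pose t := Num.min (e / rho) (2 * M * rho)^-1.
have Mr : 0 < 2 * M * rho by rewrite !mulr_gt0.
have t0 : 0 < t by rewrite lt_min divr_gt0// invr_gt0.
exists (t / 2) => [|x xrho]; first by rewrite divr_gt0.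
have [d Td [xd dT]] := moreau x Tc T0 TD TZ.
have xE : `|x| ^+ 2 = `|x - d| ^+ 2 + `|d| ^+ 2.
  by rewrite -{1}(subrK d x) inner_sqD xd mul0rn addr0.
exists (x - d); split.
- exact: dT.
- apply: le_trans xrho; rewrite -ler_sqr ?nnegrE// xE lerDl sqr_ge0//.
have drho : `|d| <= rho.
  by apply: le_trans xrho; rewrite -ler_sqr ?nnegrE// xE lerDr sqr_ge0.
have tde : `|t *: d| <= e.
  rewrite normrZ gtr0_norm// (@le_trans _ _ (t * rho))//.
    by rewrite ler_wpM2l// ltW.
  by rewrite -ler_pdivlMr// ge_min lexx.
have [w /= Cw wu] := CTe _ (TZ _ _ t0 Td) tde.
apply: le_trans ((polar_le1P w gg).1 Cw x); rewrite lee_fin.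
have -> : x - (x - d) = d by rewrite subKr.
have -> : inner w x = inner u x + t * inner d x + inner (w - u - t *: d) x.
  by rewrite !innerE; ring.
have -> : inner d x = `|d| ^+ 2.
  by rewrite -inner_norm -[x in LHS](subrK d) innerDr innerC xd add0r.
have H : - (t / 2 * `|d| ^+ 2) <= inner (w - u - t *: d) x.
  rewrite lerNl -innerNl (le_trans (cauchy_schwarz _ _))// normrN.
  rewrite (@le_trans _ _ (M * `|t *: d| ^+ 2 * rho))//.
    by apply: ler_pM.
  rewrite normrZ gtr0_norm//.
  have -> : M * (t * `|d|) ^+ 2 * rho =
      (t * (2 * M * rho)) * (t / 2 * `|d| ^+ 2).
    by field.
  rewrite -[leRHS]mul1r ler_wpM2r//.
    by rewrite !mulr_ge0 ?sqr_ge0// ltW.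
  by rewrite -ler_pdivlMr// mul1r ge_min lexx orbT.
by lra.
Qed.

End normal_cone.

(** * Linear regularity of a cone along the fibers of a linear map *)

Section regularity.
Context {R : realType} {X : euclideanType R}.

(** A finite list of elements of [N] with span of maximal dimension already spans all of [N]. The
    second clause is the induction principle for this span. *)
Lemma span_set (N : set X) : exists U : {vspace X},
  (forall n, N n -> n \in U) /\
  forall P : set X, P 0 -> (forall (a : R) x y, P x -> P y -> P (a *: x + y)) ->
    N `<=` P -> forall m, m \in U -> P m.
Proof.
pose Q k := `[< exists s : seq X, (forall x, x \in s -> N x) /\
  \dim << s >>%VS = k >].
have Q0 : exists k, Q k.
  by exists 0; apply/asboolP; exists [::]; rewrite span_nil dimv0.
have Qmax k : Q k -> (k <= \dim {: X})%N.
  by move=> /asboolP[s [_ <-]]; apply: dimvS; exact: subvf.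
case: (ex_maxnP Q0 Qmax) => k /asboolP[s [sN sk]] kmax.
exists << s >>%VS; split=> [n Nn|P P0 PD NP m ms].
  have : (<< s >> == << n :: s >>)%VS.
    rewrite eqEdim sk; apply/andP; split.
      by rewrite span_cons addvSr.
    apply: kmax; apply/asboolP; exists (n :: s); split=> // x.
    by rewrite inE => /predU1P[->//|/sN].
  by move=> /eqP ->; rewrite memv_span// mem_head.
rewrite (coord_span (X := in_tuple s) ms); apply: big_ind => //.
  by move=> x y Px Py; rewrite -[x]scale1r; exact: PD.
move=> i _; rewrite -[_ *: _]addr0; apply: PD => //.
by apply/NP/sN/mem_nth; case: i.
Qed.

Lemma affine_aff_hull (S : set X) : affine_set (aff_hull S).
Proof.
move=> x y t Sx Sy P [Paff SP].
exact: Paff (Sx _ (conj Paff SP)) (Sy _ (conj Paff SP)).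
Qed.

Lemma sub_aff_hull (S : set X) : S `<=` aff_hull S.
Proof. exact: sub_smallest. Qed.

(* [S] is a base of the cone [N], up to its recession directions: an affine
   ball around [g0] in [S] extends to a linear ball in the span of [N]. *)
Lemma rel_interior_cone_base (N S : set X) (u g0 : X) :
  (forall y z, N y -> N z -> N (y + z)) ->
  (forall (t : R) y, 0 < t -> N y -> N (t *: y)) ->
  (forall n, N n -> 0 <= inner n u) ->
  (forall n, S n <-> N n /\ inner n u = 1) ->
  rel_interior S g0 ->
  exists U : {vspace X}, (forall n, N n -> n \in U) /\
    exists2 r : R, 0 < r & forall m, m \in U -> `|m| <= r -> N (g0 + m).
Proof.
move=> ND NZ Nu SN [Sg0 [e e0 eS]].
have [Ng0 g0u] := (SN g0).1 Sg0.
pose P := aff_hull S.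
have Paff : affine_set P by exact: affine_aff_hull.
have Pg0 : P g0 by exact: sub_aff_hull.
have PZ (a : R) x : P (g0 + x) -> P (g0 + a *: x).
  move=> Px; have -> : g0 + a *: x = a *: (g0 + x) + (1 - a) *: g0.
    by apply: inner_ext => z; rewrite !innerE; ring.
  exact: Paff.
have PD x y : P (g0 + x) -> P (g0 + y) -> P (g0 + (x + y)).
  move=> Px Py; have -> : g0 + (x + y) =
      2^-1 *: (g0 + 2%:R *: x) + (1 - 2^-1) *: (g0 + 2%:R *: y).
    by apply: inner_ext => z; rewrite !innerE; field.
  by apply: Paff; apply: PZ.
have [U [NU UP]] := span_set N.
(* As [<g0,u> = 1], subtracting [<m,u> g0] moves [m] into the hyperplane orthogonal to [u]; [Q m]
   says that the result is a direction of the affine hull. *)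
pose Q m := P (g0 + (m - inner m u *: g0)).
have {}UP m : m \in U -> Q m.
  apply: UP => [|a x y Px Py|n Nn].
  - by rewrite /Q inner0l scale0r subr0 addr0.
  - rewrite /Q; have -> : a *: x + y - inner (a *: x + y) u *: g0 =
        a *: (x - inner x u *: g0) + (y - inner y u *: g0).
      by apply: inner_ext => z; rewrite !innerE; ring.
    by apply: PD => //; apply: PZ.
  - rewrite /Q; have := Nu _ Nn; rewrite le_eqVlt => /predU1P[n0|n0].
      (* Here [n] is a recession direction: [g0 + n] is still in [S]. *)
      rewrite -n0 scale0r subr0; apply: sub_aff_hull; apply/SN; split.
        exact: ND.
      by rewrite innerDl g0u -n0 addr0.
    have -> : n - inner n u *: g0 = inner n u *: ((inner n u)^-1 *: n - g0).
      by apply: inner_ext => z; rewrite !innerE; field; rewrite gt_eqF.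
    apply: PZ; rewrite addrC subrK; apply: sub_aff_hull; apply/SN; split.
      by apply: NZ => //; rewrite invr_gt0.
    by rewrite innerZl mulVf// gt_eqF.
exists U; split=> //.
(* The first bound keeps the height [b] of [g0 + m] above one half; the second keeps the point
   rescaled to height 1 within [e] of [g0]. *)
pose r := Num.min (2 * (`|u| + 1))^-1 (e / (4 * (1 + `|u| * `|g0|))).
have u1 : 0 < 2 * (`|u| + 1) by rewrite mulr_gt0// ltr_wpDl.
have ug : 0 < 4 * (1 + `|u| * `|g0|) by rewrite mulr_gt0// ltr_wpDr// mulr_ge0.
exists r; first by rewrite lt_min invr_gt0 u1 divr_gt0.
move=> m mU; rewrite le_min => /andP[mr1 mr2].
have mu : `|inner m u| <= 2^-1.
  rewrite (le_trans (norm_inner_le _ _))//.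
  move: mr1; rewrite -[leRHS]mul1r ler_pdivlMr// => H.
  by have := normr_ge0 m; nra.
pose b := 1 + inner m u.
have b2 : 2^-1 <= b by move: mu; rewrite ler_norml /b => /andP[? _]; lra.
have b0 : 0 < b by lra.
have : S (b^-1 *: (g0 + m)).
  have hE : b^-1 *: (g0 + m) = g0 + b^-1 *: (m - inner m u *: g0).
    by apply: inner_ext => z; rewrite !innerE /b; field; rewrite gt_eqF.
  apply: eS; split; last by rewrite hE; apply: PZ; exact: UP.
  rewrite -ball_normE /ball_/= hE opprD addrA subrr sub0r normrN normrZ.
  rewrite gtr0_norm ?invr_gt0// ltr_pdivrMl//.
  rewrite (@lt_le_trans _ _ (2^-1 * e))//; last by rewrite ler_pM2r.
  rewrite (le_lt_trans (ler_normB _ _))// normrZ.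
  have H1 := norm_inner_le m u.
  have H2 : `|inner m u| * `|g0| <= `|m| * (`|u| * `|g0|).
    by rewrite mulrA ler_wpM2r.
  move: mr2; rewrite ler_pdivlMr// => H3.
  by rewrite (le_lt_trans (lerD (lexx _) H2))//; lra.
move=> /SN[+ _]; move=> /(NZ _ _ b0); rewrite scalerA mulfV ?scale1r//.
by rewrite gt_eqF.
Qed.

(* If [A n] is close to [A z], correct [n] by [-m] with [m] in [U] and
   [A m = A n - A z], then move towards [z] to fall back into [N]. *)
Lemma cone_fiber_regularity (Y : euclideanType R) (A : {linear X -> Y})
    (N : set X) (U : {vspace X}) (z : X) (r rho : R) :
  (forall y z, N y -> N z -> N (y + z)) ->
  (forall (t : R) y, 0 < t -> N y -> N (t *: y)) ->
  (forall n, N n -> n \in U) -> 0 < r -> 0 < rho ->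
  (forall m, m \in U -> `|m| <= r -> N (z + m)) ->
  exists2 k : R, 0 < k & forall n, N n -> `|n| <= rho ->
    exists p, [/\ N p, A p = A z & `|n - p| <= k * `|A n - A z|].
Proof.
move=> ND NZ NU r0 rho0 zN.
(* Precomposing [A] with the projection on [U] allows corrections to be taken inside [U]. *)
pose f : {linear X -> Y} := (linfun A \o projv U)%VF.
have fP x : f x = A (projv U x) by rewrite [LHS]comp_lfunE lfunE.
have fE m : m \in U -> f m = A m by move=> mU; rewrite fP projv_id.
have [q [q0 [Q [Qq fQf]]]] := linear_right_inverse f.
pose PU : {linear X -> X} := projv U.
have [s s0 PUs] := linear_bounded PU.
have zU : z \in U by rewrite -[z]addr0; apply/NU/zN; rewrite ?mem0v ?normr0 ?ltW.
pose c := (rho + `|z|) / r.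
have c0 : 0 <= c by rewrite divr_ge0// ?addr_ge0// ltW.
exists (s * q * (1 + c)) => [|n Nn nrho].
  by rewrite !mulr_gt0// ltr_wpDr.
have [An|An] := eqVneq (A n) (A z).
  by exists n; rewrite An !subrr !normr0 mulr0.
pose m := projv U (Q (f (n - z))).
have mU : m \in U by exact: memv_proj.
have nzU : n - z \in U by rewrite memvB// NU.
have Am : A m = A n - A z.
  by rewrite /m -fP fQf fE// linearB.
have mle : `|m| <= s * q * `|A n - A z|.
  rewrite (le_trans (PUs _))// -mulrA ler_wpM2l ?(ltW s0)//.
  by rewrite (le_trans (Qq _))// fE// linearB.
have m0 : 0 < `|m|.
  rewrite normr_gt0; apply: contra_neq An => m0.
  by apply/eqP; rewrite -subr_eq0 -Am m0 linear0.
pose t := `|m| / (`|m| + r).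
have mr : 0 < `|m| + r by rewrite addr_gt0.
have t0 : 0 < t by rewrite divr_gt0.
have t1 : 0 < 1 - t.
  have -> : 1 - t = r / (`|m| + r) by rewrite /t; field; rewrite gt_eqF.
  by rewrite divr_gt0.
(* Since [t r / |m| = 1 - t], this point equals [(1 - t)(n - m) + t z], whose image is [A z];
   written as it is here, it is a combination of two points of [N]. *)
pose p := (1 - t) *: n + t *: (z - (r / `|m|) *: m).
have trm : t * (r / `|m|) = 1 - t.
  by rewrite /t; field; rewrite !gt_eqF.
exists p; split.
- apply: ND; apply: NZ => //; apply: zN; first by rewrite memvN memvZ.
  by rewrite normrN normrZ gtr0_norm ?divr_gt0// divfK// gt_eqF.
- have AE (a b e : R) : A (a *: n + b *: (z - e *: m)) =
      a *: A n + b *: (A z - e *: A m).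
    by rewrite linearD linearZ [A (b *: _)]linearZ linearB [A (e *: m)]linearZ.
  rewrite /p AE Am.
  apply: inner_ext => x; rewrite !innerE.
  have := congr1 ( *%R^~ (inner (A n) x - inner (A z) x)) trm => /=; lra.
have -> : n - p = t *: (n - z) + (1 - t) *: m.
  rewrite /p; apply: inner_ext => x; rewrite !innerE.
  have := congr1 ( *%R^~ (inner m x)) trm => /=; lra.
rewrite (le_trans (ler_normD _ _))// !normrZ !gtr0_norm ?invr_gt0//.
have tm : t <= `|m| / r.
  by rewrite ler_wpM2l// lef_pV2 ?posrE// lerDr ltW.
have nz : `|n - z| <= rho + `|z|.
  by rewrite (le_trans (ler_normB _ _))// lerD2r.
rewrite (@le_trans _ _ (`|m| * (1 + c)))//.
  have -> : `|m| * (1 + c) = `|m| / r * (rho + `|z|) + 1 * `|m|.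
    by rewrite /c; ring.
  apply: lerD; first by apply: ler_pM => //; exact: ltW.
  by rewrite ler_wpM2r//; lra.
by rewrite [leRHS]mulrAC ler_wpM2r// addr_ge0.
Qed.

End regularity.

(** * Quadratic growth and the KL property *)

Section kl.
Context {R : realType}.

Lemma derive1_powR_half (c s : R) : 0 < s ->
  ((fun s : R => c * s `^ (1 - 1 / 2))^`())%classic s = c / (2 * Num.sqrt s).
Proof.
move=> s0; have H := is_derive1_powR (1 - 1 / 2) s0.
rewrite derive1E (@derive_val _ _ _ _ _ _ _ (is_deriveZ c H)).
have -> : (1 - 1 / 2 - 1 : R) = - 2^-1 by field.
rewrite powRN powR12_sqrt ?ltW//.
change (c * ((1 - 1 / 2) * (Num.sqrt s)^-1) = c / (2 * Num.sqrt s)).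
by field; rewrite gt_eqF// sqrtr_gt0.
Qed.

(** For a subgradient [h] at [x] and [t = f x - f xbar], the subgradient inequality at [p] gives
    [t <= |h| |x - p|], while growth gives [c |x - p|^2 <= t]; hence [|h| >= sqrt (c t)]. *)
Lemma KL_half_of_quadratic_growth (X : euclideanType R) (f : X -> \bar R)
    (xbar : X) (r c : R) :
  proper_fun f -> lower_semicontinuous f -> dom_subdiff f xbar ->
  0 < r -> 0 < c ->
  (forall x, `|x - xbar| < r -> exists2 p, (f p <= f xbar)%E &
     (f xbar + (c * `|x - p| ^+ 2)%:E <= f x)%E) ->
  KL_property f xbar (1 / 2).
Proof.
move=> fproper flsc dfx r0 c0 growth; split => //; first lra.
have [g [fxlt _]] := dfx.
(* The constant is chosen so that the derivative of [phi] at [t] is exactly [1 / sqrt (c t)]. *)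
exists +oo%E, [set x | `|x - xbar| < r], (2 / Num.sqrt c); split=> //.
- apply/nbhs_normP; exists r => //= x; rewrite /ball_/=.
  by rewrite distrC.
- by rewrite divr_gt0// sqrtr_gt0.
move=> phi x /= xr fx fxa.
case Exb : (f xbar) (fxlt : (f xbar < +oo)%E) (fproper.2 xbar) => [b| |]// _ _.
have [p fp fxp] := growth x xr; rewrite Exb in fp fxp fx fxa *.
set phi' := (_^`())%classic _.
have dist_ge (e : R) : (forall h, subdiff f x h -> e <= `|h|) ->
    (e%:E <= dist_to (0 : X)%R (subdiff f x))%E.
  move=> H; apply: le_ereal_inf_tmp => _ [h xh <-].
  by rewrite lee_fin sub0r normrN H.
case Ex : (f x) fx fxa => [s| |] fx fxa //.
  rewrite lte_fin in fx;  pose t := s - b.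
  have t0 : 0 < t by rewrite subr_gt0.
  have ct : 0 < c * t by rewrite mulr_gt0.
  have phiE : phi' = (Num.sqrt (c * t))^-1.
    rewrite /phi' Ex /= derive1_powR_half// sqrtrM ?ltW//.
    by field; rewrite !gt_eqF ?sqrtr_gt0.
  have phi0 : 0 < phi' by rewrite phiE invr_gt0 sqrtr_gt0.
  rewrite -lee_pdivrMl// mule1; apply: dist_ge => h [_ /(_ p)].
  rewrite Ex => /le_trans/(_ fp); rewrite -EFinD lee_fin => ph.
  move: fxp; rewrite Ex -EFinD lee_fin => cs.
  rewrite phiE invrK; have th : t <= `|h| * `|x - p|.
    rewrite (le_trans _ (cauchy_schwarz _ _))// innerBr.
    by move: ph; rewrite innerBr /t; lra.
  have t2 : c * t ^+ 2 <= `|h| ^+ 2 * t.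
    apply: (@le_trans _ _ (c * (`|h| * `|x - p|) ^+ 2)).
      rewrite ler_pM2l// ler_sqr// nnegrE ?mulr_ge0//; exact: ltW.
    rewrite exprMn mulrCA ler_wpM2l ?sqr_ge0// /t; lra.
  rewrite -[leRHS]normr_id -sqrtr_sqr ler_wsqrtr//.
  by move: t2; rewrite expr2 mulrA ler_pM2r// normr_id.
Qed.

(** Divide by [t] and let [t] tend to 0. The factor [s] serves both signs: 1 for optimality and -1
    for strong convexity. *)
Lemma directional_derivative_ge (Y : euclideanType R) (l : Y -> R) (y h : Y)
    (s b c : R) : differentiable l y ->
  (forall t : R, 0 < t <= 1 ->
     t * b <= s * (l (y + t *: h) - l y) + t ^+ 2 * c) ->
  b <= s * 'd l y h.
Proof.
move=> dl H; rewrite leNgt; apply/negP => sb.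
pose gap := b - s * 'd l y h; have gap0 : 0 < gap by rewrite subr_gt0.
(* [e] and [t] are chosen so that the differentiability error and the quadratic term are each at
   most [t gap / 4]. *)
pose e := gap / (4 * (`|s| + 1) * (`|h| + 1)).
have s1 : 0 < `|s| + 1 by rewrite ltr_wpDl.
have h1 : 0 < `|h| + 1 by rewrite ltr_wpDl.
have c1 : 0 < `|c| + 1 by rewrite ltr_wpDl.
have e0 : 0 < e by rewrite divr_gt0// !mulr_gt0.
have [d d0 dP] := diff_estimate (V := R^o) e0 dl.
pose t := Num.min 1 (Num.min (d / (`|h| + 1)) (gap / (4 * (`|c| + 1)))).
have t0 : 0 < t by rewrite !lt_min ltr01 !divr_gt0// mulr_gt0.
have [t1 td tc] : [/\ t <= 1, t * (`|h| + 1) <= d & t * (4 * (`|c| + 1)) <= gap].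
  by split; rewrite -?ler_pdivlMr// ?mulr_gt0// /t !ge_min lexx ?orbT.
have th : t * `|h| <= d by rewrite (le_trans _ td)// ler_pM2l// lerDl.
have := dP (t *: h); rewrite normrZ gtr0_norm// linearZ => /(_ th) le.
have := H t; rewrite t0 t1 => /(_ isT).
set L := l _ - l y in le * => tb.
have sL : s * L <= s * (t * 'd l y h) + `|s| * (e * (t * `|h|)).
  rewrite -lerBlDl -mulrBr (le_trans (ler_norm _))// normrM ler_wpM2l//.
have tc2 : t ^+ 2 * c <= t * (gap / 4).
  rewrite expr2 -mulrA ler_pM2l// ler_pdivlMr// (le_trans _ tc)//.
  rewrite -mulrA ler_pM2l// mulrC ler_pM2l//.
  by rewrite (le_trans (ler_norm _))// lerDl.
have es : `|s| * (e * (t * `|h|)) <= t * (gap / 4).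
  have -> : t * (gap / 4) = (`|s| + 1) * (e * (t * (`|h| + 1))).
    by rewrite /e; field; rewrite !gt_eqF.
  apply: ler_pM; rewrite ?lerDl//; first by rewrite !mulr_ge0// ltW.
  by rewrite !ler_pM2l// lerDl.
have : t * gap <= t * (gap / 2) by rewrite /gap in tc2 es *; lra.
by rewrite ler_pM2l//; lra.
Qed.

Lemma convex_set_closed_ball (V : euclideanType R) (x : V) (r : R) :
  0 < r -> convex_set (closed_ball x r).
Proof.
move=> r0; apply/convex_setP => t y z /andP[t0 t1].
rewrite closed_ball_norm//= => xy xz.
have -> : x - (t *: y + (1 - t) *: z) = t *: (x - y) + (1 - t) *: (x - z).
  by apply: inner_ext => w; rewrite !innerE; ring.
rewrite (le_trans (ler_normD _ _))// !normrZ !ger0_norm ?subr_ge0//.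
have : t * `|x - y| <= t * r by rewrite ler_wpM2l.
have : (1 - t) * `|x - z| <= (1 - t) * r by rewrite ler_wpM2l// subr_ge0.
lra.
Qed.

(** Strong convexity on the unit ball around [y], along the segment from [y] to [z], in the limit
    [t] to 0. *)
Lemma strongly_convex_lower_bound (Y : euclideanType R) (l : Y -> R) (y : Y) :
  (forall K : set Y, compact K -> convex_set K -> strongly_convex_on K l) ->
  differentiable l y ->
  exists2 s : R, 0 < s & forall z, `|z - y| <= 1 ->
    l y + inner (gradient l y) (z - y) + s * `|z - y| ^+ 2 <= l z.
Proof.
move=> lsc dl.
have [s s0 sP] := lsc _ (compact_closed_ball (x := y) ltr01)
  (convex_set_closed_ball (x := y) ltr01).
exists (s / 2) => [|z zy]; first by rewrite divr_gt0.
rewrite -gradientP; set D := `|z - y| ^+ 2.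
have : l y - l z + s / 2 * D <= -1 * 'd l y (z - y).
  apply: (directional_derivative_ge (c := s / 2 * D) dl) => t /andP[t0 t1].
  have := sP z y t; rewrite !closed_ball_norm//= distrC => /(_ zy).
  rewrite subrr normr0 ler01 (ltW t0) t1 => /(_ isT isT).
  have -> : t *: z + (1 - t) *: y = y + t *: (z - y).
    by apply: inner_ext => x; rewrite !innerE; ring.
  by rewrite -/D; lra.
by lra.
Qed.

Lemma lower_semicontinuous_addl (X : normedModType R) (q : X -> R)
    (g : X -> \bar R) : continuous q -> lower_semicontinuous g ->
  (forall x, (0 <= g x)%E) ->
  lower_semicontinuous (fun x => ((q x)%:E + g x)%E).
Proof.
move=> qc glsc g0 x a afx.
have [b ab bg] : exists2 b, a - q x < b & (b%:E < g x)%E.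
  move: afx; case: (g x) (g0 x) => [r| |//] _; last first.
    by exists (a - q x + 1); rewrite ?ltrDl ?ltry.
  rewrite -EFinD lte_fin => H; exists ((a - q x + r) / 2); rewrite ?lte_fin; lra.
have [V xV Vg] := glsc _ _ bg.
have e0 : 0 < b - (a - q x) by rewrite subr_gt0.
have /cvgrPdist_lt/(_ _ e0) xq := qc x.
exists (V `&` [set y | `|q x - q y| < b - (a - q x)]); first exact: filterI.
move=> y [/Vg by_ /=]; rewrite ltr_norml => /andP[_ qy].
apply: lt_trans (_ : ((q y)%:E + b%:E < _)%E).
  by rewrite -EFinD lte_fin; lra.
by rewrite lteD2lE.
Qed.

End kl.

(** * Gauge-regularized functions *)

Section gauge_regularized.
Context {R : realType} {X Y : euclideanType R}.
Variables (l : Y -> R) (A : {linear X -> Y}) (v : X) (gam : X -> \bar R).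
Hypotheses (gg : gauge gam) (dl : forall y, differentiable l y).
Variable xbar : X.

Let f x : \bar R := ((l (A x) + inner v x)%:E + gam x)%E.
Let u := - adjoint A (gradient l (A xbar)) - v.

Lemma inner_dual x : inner u x = - inner (gradient l (A xbar)) (A x) - inner v x.
Proof. by rewrite /u innerBl innerNl innerC -adjointP innerC. Qed.

Hypotheses (xmin : subdiff f xbar 0) (gxbar : (0 < gam xbar)%E).

(** By [sub], [u] is a subgradient of [gam] at [xbar]. Testing at [0] and [2 xbar] gives
    [<u,xbar> = gam xbar], so the supremum defining the polar is attained at the normalized
    [xbar]. *)
Lemma minimizer_polar :
  polar gam u = 1%E /\ gam xbar = (inner u xbar)%:E.
Proof.
have [gc gge0 gZ g0] := gg; have [fx fmin] := xmin.
have fle y : (f xbar <= f y)%E.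
  by have := fmin y; rewrite inner0l adde0.
move: fx gxbar; rewrite /edom /= /f.
case gx : (gam xbar) => [b| |]// _; rewrite lte_fin => b0.
(* Minimality along the segment to [z], with convexity bounding [gam] there, compares difference
   quotients of the smooth part. *)
have sub z (s : R) : gam z = s%:E -> b + inner u (z - xbar) <= s.
  move=> gz; set h := z - xbar.
  suff : b - s - inner v h <= 1 * 'd l (A xbar) (A h).
    by rewrite mul1r gradientP inner_dual; lra.
  apply: (directional_derivative_ge (c := 0) (dl _)) => t /andP[t0 t1].
  rewrite mulr0 addr0 mul1r.
  have t01 : 0 <= t <= 1 by rewrite ltW.
  have xt : t *: z + (1 - t) *: xbar = xbar + t *: h.
    by apply: inner_ext => x; rewrite !innerE; ring.
  clearbody h; have := gc z xbar t t01; rewrite xt gz gx -!EFinM -EFinD.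
  have := fle (xbar + t *: h); rewrite /f gx.
  case: (gam (xbar + t *: h)) (gge0 (xbar + t *: h)) => [c| |]// _.
  rewrite -!EFinD !lee_fin linearD linearZ/= !innerDr innerZr.
  by lra.
have ux : inner u xbar = b.
  have := sub 0 0 g0; rewrite sub0r innerNr => H1.
  have := sub (2%:R *: xbar) (2 * b); rewrite gZ// gx => /(_ erefl).
  by rewrite innerBr innerZr; lra.
split; last by rewrite ux.
apply/eqP; rewrite eq_le; apply/andP; split.
  apply/polar_le1P => // z.
  case gz : (gam z) (gge0 z) => [s| |]// _; last by rewrite leey.
  by have := sub z s gz; rewrite innerBr lee_fin ux; lra.
apply: ereal_sup_ubound; exists (b^-1 *: xbar).
  by rewrite /= gZ ?invr_gt0// gx -EFinM lee_fin mulVf// gt_eqF.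
by rewrite innerZr ux mulVf// gt_eqF.
Qed.

Hypothesis glsc : lower_semicontinuous gam.
Hypothesis l_sc : forall K : set Y, compact K -> convex_set K ->
  strongly_convex_on K l.
Hypothesis polar_red : C2_cone_reducible (polar gam).

Lemma gauge_regularized_growth :
  A @^-1` [set A xbar] `&`
     (\bigcup_(lam in [set lam : R | 0 < lam])
        [set lam *: g | g in rel_interior (subdiff (polar gam) u)]) !=set0 ->
  exists r c : R, [/\ 0 < r, 0 < c & forall x, `|x - xbar| < r ->
    exists2 p, (f p <= f xbar)%E &
     (f xbar + (c * `|x - p| ^+ 2)%:E <= f x)%E].
Proof.
have [gu gx] := minimizer_polar; have [_ gge0 _ _] := gg.
move=> [z [/= Az [lam /= lam0 [g0 rg0 zE]]]]; rewrite -{z}zE in Az.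
have [T CT] := reducible_second_order_tangent gg polar_red gu.
pose N := polar_cone T.
have ND y z : N y -> N z -> N (y + z).
  by move=> Ny Nz d Td; rewrite innerDl -[leRHS]addr0 lerD ?Ny ?Nz.
have NZ (t : R) y : 0 < t -> N y -> N (t *: y).
  by move=> t0 Ny d Td; rewrite innerZl pmulr_rle0// Ny.
have [U [NU [r r0 Nr]]] := rel_interior_cone_base ND NZ
  (polar_cone_inner_ge0 CT) (subdiff_polarP gg gu CT) rg0.
(* The qualification point is [lam g0], so the ball in [N] around [g0] is scaled by [lam]. *)
have zN m : m \in U -> `|m| <= lam * r -> N (lam *: g0 + m).
  move=> mU mr; have -> : lam *: g0 + m = lam *: (g0 + lam^-1 *: m).
    by apply: inner_ext => x; rewrite !innerE; field; rewrite gt_eqF.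
  apply/NZ/Nr => //; first exact: memvZ.
  by rewrite normrZ gtr0_norm ?invr_gt0// ler_pdivrMl.
have rho0 : 0 < `|xbar| + 1 by rewrite ltr_wpDl.
have [k k0 kP] := cone_fiber_regularity A ND NZ NU (mulr_gt0 lam0 r0) rho0 zN.
have [c c0 cP] := gauge_quadratic_growth gg CT rho0.
have [s s0 sP] := strongly_convex_lower_bound l_sc (dl (A xbar)).
have [a a0 aP] := linear_bounded A.
pose a1 := 1 + k * a.
have a10 : 0 < a1 by rewrite addr_gt0// mulr_gt0.
have a20 : 0 < a1 ^+ 2 by rewrite exprn_gt0.
have k20 : 0 < k ^+ 2 by rewrite exprn_gt0.
(* The factors [2 a1^2] and [2 k^2] come from squaring the bound [xp] on [|x - p|] by
   [(y + z)^2 <= 2 y^2 + 2 z^2]. *)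
pose e := Num.min (c / (2 * a1 ^+ 2)) (s / (2 * k ^+ 2)).
(* The radius ensures both [|x| <= |xbar| + 1] and [|A x - A xbar| <= 1], where the local bounds
   hold. *)
exists (Num.min 1 a^-1), e; split.
- by rewrite lt_min ltr01 invr_gt0.
- by rewrite lt_min !divr_gt0// mulr_gt0.
move=> x; rewrite lt_min => /andP[x1 xa].
have xrho : `|x| <= `|xbar| + 1.
  rewrite -(subrK xbar x) addrC (le_trans (ler_normD _ _))// lerD2l.
  exact: ltW.
have [n [Nn nrho gx']] := cP x xrho.
have [p [Np Ap np]] := kP n Nn nrho.
exists p.
  have := gauge_polar_cone gg gu CT glsc Np; rewrite /f gx Ap Az.
  case: (gam p) (gge0 p) => [q| |]// _; rewrite -!EFinD !lee_fin !inner_dual.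
  by rewrite Ap Az; lra.
rewrite /f gx -!EFinD; apply: le_trans (leeD (lexx _) gx').
rewrite -!EFinD lee_fin.
have Ax1 : `|A x - A xbar| <= 1.
  rewrite -linearB (le_trans (aP _))// -ler_pdivlMl// mulr1.
  exact: ltW.
have := sP _ Ax1; rewrite innerBr.
rewrite !inner_dual.
set Dy := `|A x - A xbar|; set Dn := `|x - n|.
suff : e * `|x - p| ^+ 2 <= c * Dn ^+ 2 + s * Dy ^+ 2 by lra.
(* Go from [x] to [n], then to [p] at a cost [k |A n - A xbar|], itself bounded by passing through
   [A x]. *)
have xp : `|x - p| <= a1 * Dn + k * Dy.
  rewrite -(subrKA n) (le_trans (ler_normD _ _))//.
  have : `|A n - A (lam *: g0)| <= a * Dn + Dy.
    rewrite Az -(subrKA (A x)) (le_trans (ler_normD _ _))// lerD2r.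
    by rewrite -linearB (le_trans (aP _))// distrC.
  move=> /(ler_wpM2l (ltW k0)) H.
  by rewrite /a1; have := le_trans np H; rewrite /Dn; lra.
apply: (@le_trans _ _ (e * (2 * (a1 ^+ 2 * Dn ^+ 2 + k ^+ 2 * Dy ^+ 2)))).
  rewrite ler_wpM2l//; first by rewrite le_min !divr_ge0// ?mulr_ge0 ?ltW.
  apply: (@le_trans _ _ ((a1 * Dn + k * Dy) ^+ 2)).
    by rewrite ler_sqr ?nnegrE// (le_trans _ xp).
  rewrite -subr_ge0 [leRHS](_ : _ = (a1 * Dn - k * Dy) ^+ 2) ?sqr_ge0//.
  by ring.
have -> : e * (2 * (a1 ^+ 2 * Dn ^+ 2 + k ^+ 2 * Dy ^+ 2)) =
   (e * (2 * a1 ^+ 2)) * Dn ^+ 2 + (e * (2 * k ^+ 2)) * Dy ^+ 2 by ring.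
apply: lerD; rewrite ler_wpM2r ?sqr_ge0// -ler_pdivlMr ?mulr_gt0//.
  by rewrite ge_min lexx.
by rewrite ge_min lexx orbT.
Qed.

End gauge_regularized.

Theorem corollary4p1 (R : realType) (X Y : euclideanType R)
    (l : Y -> R) (A : {linear X -> Y}) (v : X) (gam : X -> \bar R)
    (gam_gauge : gauge gam) (gam_closed : lower_semicontinuous gam)
    (polar_red : C2_cone_reducible (polar gam))
    (l_sc : forall K : set Y, compact K -> convex_set K ->
              strongly_convex_on K l)
    (l_grad : locally_lipschitz_gradient l)
    (xbar : X) :
  let f := fun x : X => ((l (A x) + inner v x)%:E + gam x)%E in
  let u := - adjoint A (gradient l (A xbar)) - v in
  subdiff f xbar 0 -> (0 < gam xbar)%E ->
  polar gam u = 1%E /\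
  (dom_subdiff (polar gam) u ->
   A @^-1` [set A xbar] `&`
     (\bigcup_(lam in [set lam : R | 0 < lam])
        [set lam *: g | g in rel_interior (subdiff (polar gam) u)]) !=set0 ->
   KL_property f xbar (1 / 2)).
Proof.
move=> f u xmin gx0; have [dl _] := l_grad.
split; first exact: (minimizer_polar gam_gauge dl xmin gx0).1.
move=> _ /(gauge_regularized_growth gam_gauge dl xmin gx0 gam_closed l_sc
  polar_red)[r [c [r0 c0 growth]]].
have gge0 : forall x, (0 <= gam x)%E by case: gam_gauge.
apply: (KL_half_of_quadratic_growth _ _ _ r0 c0 growth).
- split; first by exists xbar; case: xmin.
  by move=> x; rewrite /f; case: (gam x) (gge0 x).
- apply: lower_semicontinuous_addl => // x.
  have Ac := @euclidean_linear_continuous R X Y A x.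
  have vc := @euclidean_linear_continuous R X R^o (inner v) x.
  apply: (cvgD _ vc); apply: (cvg_comp _ _ Ac).
  exact: (differentiable_continuous (dl _)).
- by exists 0.
Qed.
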